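(* Let $n\ge 1$. There exists a partition $P^*$ of $\mathbf{R}^n$ into regions of unit volume which minimizes the limit superior of the perimeter per volume ratio for balls about the origin; that is, for every partition $P$ of $\mathbf{R}^n$ into regions of unit volume, $$\limsup_{r\to\infty} a_{P^*}(r)\;\le\;\limsup_{r\to\infty} a_{P}(r),$$ where $a_P(r)$ denotes the perimeter per volume ratio of $P$ inside the closed ball of radius $r$ about the origin.
   Context: A partition $P$ of $\mathbf{R}^n$ into regions of unit volume is a countable family $P=\{R_j\}$ of pairwise disjoint Lebesgue measurable subsets (regions) of $\mathbf{R}^n$ with $\bigcup_j R_j=\mathbf{R}^n$, each having $n$-dimensional Lebesgue measure (volume) exactly $1$. Regions are not required to be connected or bounded. For $r>0$ let $\overline{B}_r=\{x\in\mathbf{R}^n: |x|\le r\}$ and let $|\overline{B}_r|$ be its volume. The perimeter of a family of regions is the $(n-1)$-dimensional Hausdorff measure $\mathcal{H}^{n-1}$ of the union of the topological boundaries of the regions. The perimeter per volume ratio of $P$ inside the closed ball of radius $r$ is obtained by restricting the regions to the ball: $$a_P(r)=\frac{\mathcal{H}^{n-1}\Big(\bigcup_j \partial\big(R_j\cap \overline{B}_r\big)\Big)}{|\overline{B}_r|}\in[0,\infty],$$ where $\partial$ denotes topological boundary in $\mathbf{R}^n$. *)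

(* Defs.v *)
From mathcomp Require Import all_boot all_order all_algebra.
From mathcomp Require Import all_classical all_reals all_analysis.

Set Implicit Arguments.
Unset Strict Implicit.
Unset Printing Implicit Defensive.

Import Order.TTheory GRing.Theory Num.Theory.
Import numFieldNormedType.Exports.

Local Open Scope classical_set_scope.
Local Open Scope ring_scope.

(* R^n is 'rV[R]_n. The norm carried by this type is the sup norm, so the
   Euclidean norm is introduced separately; both induce the same topology, and
   closure and interior below are the library's. *)
Definition enorm (R : realType) (n : nat) (x : 'rV[R]_n) : R :=
  Num.sqrt (\sum_(i < n) x ord0 i ^+ 2).

Definition eball (R : realType) (n : nat) (r : R) : set 'rV[R]_n :=
  [set x | enorm x <= r].

Definition boundary (T : topologicalType) (A : set T) : set T :=
  closure A `\` interior A.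

Definition box (R : realType) (n : nat) (a b : 'rV[R]_n) : set 'rV[R]_n :=
  [set x | forall i, a ord0 i <= x ord0 i <= b ord0 i].

(* Covers are infinite sequences; a box may be degenerate (a i = b i), so that
   finite and countable covers give the same infimum as soon as 0 < n. *)
Definition lebesgue_outer (R : realType) (n : nat) (X : set 'rV[R]_n) : \bar R :=
  ereal_inf
    [set (\sum_(0 <= k <oo)
            (\prod_(i < n) ((I k).2 ord0 i - (I k).1 ord0 i))%:E)%E
    | I in [set I : nat -> 'rV[R]_n * 'rV[R]_n |
        (forall k i, (I k).1 ord0 i <= (I k).2 ord0 i) /\
        X `<=` \bigcup_k box (I k).1 (I k).2]].

(* On Lebesgue measurable sets the Lebesgue measure is the restriction of
   [lebesgue_outer]. *)
Definition lebesgue_measurable (R : realType) (n : nat) (A : set 'rV[R]_n) : Prop :=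
  (@lebesgue_outer R n).-caratheodory A.

(* Volume of the unit ball of R^m, by the recurrence
   omega_(m+2) = 2 pi / (m+2) * omega_m. *)
Fixpoint unit_ball_volume (R : realType) (m : nat) : R :=
  match m with
  | 0 => 1
  | 1 => 2
  | m'.+2 => 2 * pi / (m'.+2)%:R * unit_ball_volume R m'
  end.

(* Equal to -oo on the empty set. *)
Definition ediam (R : realType) (n : nat) (E : set 'rV[R]_n) : \bar R :=
  ereal_sup [set (enorm (x - y))%:E | x in E & y in E].

(* omega_m (diam E / 2)^m, with 0^0 = 1 for nonempty E, so that H^0 counts
   points. *)
Definition hausdorff_gauge (R : realType) (n m : nat) (E : set 'rV[R]_n) : \bar R :=
  if E == set0 then 0%E
  else ((unit_ball_volume R m / 2 ^+ m)%:E * ediam E ^+ m)%E.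

Definition hausdorff_delta (R : realType) (n m : nat) (delta : R)
    (X : set 'rV[R]_n) : \bar R :=
  ereal_inf
    [set (\sum_(0 <= k <oo) hausdorff_gauge m (E k))%E
    | E in [set E : nat -> set 'rV[R]_n |
        (forall k, (ediam (E k) <= delta%:E)%E) /\ X `<=` \bigcup_k E k]].

(* The m-dimensional Hausdorff (outer) measure on R^n. *)
Definition hausdorff (R : realType) (n m : nat) (X : set 'rV[R]_n) : \bar R :=
  ereal_sup [set hausdorff_delta m delta X | delta in [set delta : R | 0 < delta]].

Definition unit_partition (R : realType) (n : nat) (P : set (set 'rV[R]_n)) : Prop :=
  [/\ countable P,
      trivIset P id,
      \bigcup_(A in P) A = setT &
      forall A, P A -> lebesgue_measurable A /\ lebesgue_outer A = 1%E].

Definition perimeter (R : realType) (n : nat) (P : set (set 'rV[R]_n)) : \bar R :=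
  hausdorff n.-1 (\bigcup_(A in P) boundary A).

Definition perimeter_ratio (R : realType) (n : nat) (P : set (set 'rV[R]_n))
    (r : R) : \bar R :=
  (perimeter [set A `&` eball r | A in P] / lebesgue_outer (@eball R n r))%E.

(* Main.v *)
From HB Require Import structures.
Require Import Defs.
From mathcomp Require Import all_boot all_order all_algebra.
From mathcomp Require Import all_classical all_reals all_analysis.
From mathcomp Require Import measurable_realfun ring lra.

(** Regions need not be connected, so a region may be completed by a piece placed
    arbitrarily far away.  Let [a] be the infimum of the limits superior and [c k]
    a partition whose limit superior is less than [a + e k].  Use [c k] in a
    spherical annulus, merging its traces there into finitely many pieces of
    volume at most 1: merging never enlarges the union of the boundaries, because
    that union is the set of points near which the partition is not locally
    constant.  The volume each piece lacks is a debt, paid by one of finitely many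
    thin concentric shells placed beyond the next annulus, at a radius so large
    that the spheres bounding these shells are negligible.

    The [k]-th annulus starts at a radius where the boundary area of [c k] inside
    the ball is at least [a - e k] times the volume.  Since the shells leave a gap,
    the Hausdorff measure is additive across it, and the part of [c k] beyond the
    start costs at most [(a + e k) v - (a - e k) u], where [u] and [v] are the
    volumes of the inner and outer balls.  Added to the cost [(a + o(1)) u] of
    what lies inside, this is [(a + o(1)) v]. *)

Set Implicit Arguments.
Unset Strict Implicit.
Unset Printing Implicit Defensive.

Import Order.TTheory GRing.Theory Num.Theory.
Import numFieldNormedType.Exports.

Local Open Scope classical_set_scope.
Local Open Scope ring_scope.

(** * Outer measures defined by countable covers *)

Section cover_outer.
Local Open Scope ereal_scope.
Context (R : realType) (T J : Type).
Variables (adm : J -> Prop) (S : J -> set T) (g : J -> \bar R).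

(** Common form of [lebesgue_outer], where [J] holds the pairs of corners of boxes, and of
    [hausdorff_delta], where [adm] bounds the diameter. *)
Definition cover_outer (X : set T) : \bar R :=
  ereal_inf [set \sum_(0 <= k <oo) g (I k)
            | I in [set I : nat -> J |
                (forall k, adm (I k)) /\ X `<=` \bigcup_k S (I k)]].

Hypothesis g_ge0 : forall j, adm j -> 0 <= g j.

Lemma cover_outer_ge0 X : 0 <= cover_outer X.
Proof.
by apply/le_ereal_inf_tmp => _ [I [admI _] <-]; apply: nneseries_ge0 => k _ _; exact: g_ge0.
Qed.

Lemma le_cover_outer : {homo cover_outer : X Y / X `<=` Y >-> X <= Y}.
Proof.
move=> X Y XY; apply: ereal_inf_le_tmp => _ [I [admI YI] <-]; exists I => //.
by split => //; exact: subset_trans YI.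
Qed.

Lemma cover_outer_le_sum (I : nat -> J) X :
  (forall k, adm (I k)) -> X `<=` \bigcup_k S (I k) ->
  cover_outer X <= \sum_(0 <= k <oo) g (I k).
Proof. by move=> admI XI; apply: ereal_inf_lbound; exists I. Qed.

Lemma cover_outer_sigma_subadditive : sigma_subadditive cover_outer.
Proof.
move=> A; have [[i ioo]|] := pselect (exists i, cover_outer (A i) = +oo).
  rewrite (eseries_pinfty _ _ ioo) ?leey// => n _.
  by rewrite -ltNye (lt_le_trans _ (cover_outer_ge0 _)).
rewrite -forallNE => Aoo.
apply/lee_addgt0Pr => e e0.
rewrite (le_trans _ (epsilon_trick _ _ (ltW e0)))//; last first.
  by move=> n; exact: cover_outer_ge0.
have cov n : exists I : nat -> J, [/\ forall k, adm (I k),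
    A n `<=` \bigcup_k S (I k) &
    \sum_(0 <= k <oo) g (I k) <= cover_outer (A n) + (e / (2 ^ n.+1)%:R)%:E].
  have fin : cover_outer (A n) \is a fin_num.
    by rewrite ge0_fin_numE ?cover_outer_ge0// ltey; apply/eqP.
  have en : (0 < e / (2 ^ n.+1)%:R)%R by rewrite divr_gt0// ltr0n expn_gt0.
  have [_ [I [admI AI] <-] lt] := lb_ereal_inf_adherent en fin.
  by exists I; split => //; exact: ltW.
have [G PG] := choice cov.
pose G' (p : nat * nat) := G p.1 p.2.
have gG_ge0 p : 0 <= g (G' p) by have [aG _ _] := PG p.1; exact/g_ge0/aG.
apply: (@le_trans _ _ (\sum_(0 <= n <oo) \sum_(0 <= k <oo) g (G n k))).
  (* A bijection from [nat] to [nat * nat] lists the near-optimal covers of all the [A n] as a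
     single sequence. *)
  have /card_esym/ppcard_eqP[f] := card_nat2.
  apply: (@le_trans _ _ (\sum_(0 <= k <oo) g (G' (f k)))).
    apply: (@cover_outer_le_sum (G' \o f)) => [k|].
      by have [aG _ _] := PG (f k).1; exact: aG.
    move=> t [n _ Ant]; have [_ AG _] := PG n; have [k _ Gt] := AG _ Ant.
    exists (f^-1%FUN (n, k)) => //=; rewrite invK ?inE//.
  rewrite nneseries_esumT//.
  rewrite -(@reindex_esum _ _ _ [set: nat] [set: nat * nat] f (g \o G')) //.
  have -> : [set: nat * nat] = setT `*`` (fun=> setT).
    by apply/seteqP; split.
  rewrite -(@esum_esum _ _ _ setT (fun=> setT) (fun n k => g (G n k)))//; last first.
    by move=> n k _ _; exact: (gG_ge0 (n, k)).
  rewrite nneseries_esumT; last first.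
    by move=> n; apply: nneseries_ge0 => k _ _; exact: (gG_ge0 (n, k)).
  apply: le_esum => n _; rewrite nneseries_esumT// => k; exact: (gG_ge0 (n, k)).
apply: lee_nneseries => n _.
  by move=> _; apply: nneseries_ge0 => k _ _; exact: (gG_ge0 (n, k)).
by have [_ _ +] := PG n; apply.
Qed.

Hypothesis triv : exists2 j, adm j & g j = 0.

Lemma cover_outer0 : cover_outer set0 = 0.
Proof.
have [j admj gj] := triv; apply/eqP; rewrite eq_le cover_outer_ge0 andbT.
apply: le_trans (@cover_outer_le_sum (fun=> j) _ _ _) _ => //.
by rewrite eseries0.
Qed.

Lemma cover_outer_le1 j X : adm j -> X `<=` S j -> cover_outer X <= g j.
Proof.
move=> admj Xj; have [j0 admj0 gj0] := triv.
(* The index of zero cost pads the one set to an infinite cover. *)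
apply: le_trans (@cover_outer_le_sum (fun k => if k is 0%N then j else j0) _ _ _) _.
- by case.
- by move=> x /Xj; exists 0%N.
rewrite (nneseries_split 0 1)//; last by case => [|k] _ //; exact: g_ge0.
by rewrite big_nat1 eseries0 ?adde0//; case.
Qed.

End cover_outer.

Section outer_measure_prop.
Local Open Scope ereal_scope.
Context (R : realType) (T : Type) (mu : set T -> \bar R).
Hypothesis mu0 : mu set0 = 0.
Hypothesis mu_ge0 : forall X, 0 <= mu X.
Hypothesis mu_sub : sigma_subadditive mu.

Lemma sigma_subadditiveU A B : mu (A `|` B) <= mu A + mu B.
Proof.
rewrite -bigcup2E; apply: le_trans (mu_sub _) _.
rewrite (nneseries_split 0 2)//.
rewrite (@eseries0 _ _ (0 + 2)%N) ?adde0//; last by case=> [|[|k]].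
by rewrite add0n big_nat_recr//= big_nat1.
Qed.

End outer_measure_prop.

(** * Lebesgue outer measure *)

(* The dimension-[n.+1] case follows from the dimension-[n] case applied to the
   slices of the cover, by integrating over the first coordinate. *)
Lemma box_volume_le_cover (R : realType) (n : nat) (a b : 'I_n -> R)
    (A B : nat -> 'I_n -> R) (P : pred nat) :
    (forall i, a i <= b i) -> (forall k i, A k i <= B k i) ->
    (forall x : 'I_n -> R, (forall i, a i <= x i <= b i) ->
       exists2 k, P k & forall i, A k i <= x i <= B k i) ->
  ((\prod_(i < n) (b i - a i))%:E <=
   \sum_(0 <= k <oo) (if P k then \prod_(i < n) (B k i - A k i) else 0)%:E)%E.
Proof.
elim: n a b A B P => [|n IH] a b A B P ab AB cov.
  have [i|k Pk _] := cov (fun=> 0); first by case: i.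
  rewrite big_ord0; apply: le_trans (nneseries_lim_ge k.+1 _).
    rewrite big_nat_recr//= Pk big_ord0 leeDr//.
    by apply: sume_ge0 => j _; case: ifP; rewrite ?big_ord0 ?lee_fin.
  by move=> j _ _; case: ifP; rewrite ?big_ord0 ?lee_fin.
pose pB k := \prod_(i < n) (B k (lift ord0 i) - A k (lift ord0 i)).
have pB0 k : 0 <= pB k by apply: prodr_ge0 => i _; rewrite subr_ge0.
pose I k := `[A k ord0, B k ord0]%classic.
pose q k := if P k then pB k else 0.
have q0 k : 0 <= q k by rewrite /q; case: ifP.
pose p := \prod_(i < n) (b (lift ord0 i) - a (lift ord0 i)).
(* Only the boxes that reach height [t] cover the slice there; the predicate [P] serves to discard
   the others in the induction. *)
have slice t : a ord0 <= t <= b ord0 ->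
    (p%:E <= \sum_(0 <= k <oo) (q k * \1_(I k) t)%:E)%E.
  move=> tab; apply: le_trans (IH _ _ (fun k i => A k (lift ord0 i))
      (fun k i => B k (lift ord0 i))
      (fun k => P k && (A k ord0 <= t <= B k ord0)) _ _ _) _ => //.
    move=> x xab.
    have [i|k Pk Bk] := cov (fun i => if unlift ord0 i is Some j then x j else t).
      by case: unliftP => [j ->|->].
    exists k; first by rewrite Pk/=; have := Bk ord0; rewrite unlift_none.
    by move=> i; have := Bk (lift ord0 i); rewrite liftK.
  apply: lee_nneseries => k _.
    by move=> _; rewrite lee_fin; case: ifP => // _; exact: pB0.
  rewrite lee_fin indicE /q.
  have [Pk|] := boolP (P k) => //=.
  have -> : (t \in I k) = (A k ord0 <= t <= B k ord0).
    by apply/idP/idP; rewrite inE /I /= in_itv.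
  by case: ifP; rewrite /= ?mulr1 ?mulr0.
have mI k : measurable (I k) by exact: measurable_itv.
have len (u v : R) : u <= v ->
    lebesgue_measure (`[u, v]%classic : set R) = (v - u)%:E.
  move=> uv; rewrite lebesgue_measure_itv/= lte_fin.
  by case: ltgtP uv => // -> _; rewrite subrr.
rewrite big_ord_recl -/p mulrC EFinM -len// -integral_cst//.
apply: (@le_trans _ _ (\int[lebesgue_measure]_(t in `[a ord0, b ord0])
    \sum_(0 <= k <oo) (q k * \1_(I k) t)%:E)%E).
  apply: ge0_le_integral => //.
  - by move=> t _; rewrite lee_fin; apply: prodr_ge0 => i _; rewrite subr_ge0.
  - apply: ge0_emeasurable_sum => [k t _ _|k _]; first by rewrite lee_fin mulr_ge0.
    by apply/measurable_EFinP; apply: measurable_funM => //; apply: measurable_indic; exact: mI.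
rewrite integral_nneseries//; last 2 first.
- move=> k; apply/measurable_EFinP; apply: measurable_funM => //.
  by apply: measurable_indic; exact: mI.
- by move=> k t _; rewrite lee_fin mulr_ge0.
apply: lee_nneseries => k _.
  by move=> _; apply: integral_ge0 => t _; rewrite lee_fin mulr_ge0.
have -> : (\int[lebesgue_measure]_(t in `[a ord0, b ord0]) (q k * \1_(I k) t)%:E
    = (q k)%:E * lebesgue_measure (I k `&` `[a ord0, b ord0]))%E.
  rewrite -integral_indic//; last exact: mI.
  apply: (@integralZl_indic _ _ _ lebesgue_measure _ _ (fun=> I k)) => //.
    by rewrite ltNge q0.
  exact: mI.
apply: (@le_trans _ _ ((q k)%:E * lebesgue_measure (I k))%E).
  rewrite lee_wpmul2l ?lee_fin//; apply: le_measure.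
  - by rewrite inE; apply: measurableI; [exact: mI|exact: measurable_itv].
  - by rewrite inE; exact: mI.
  - by move=> t [].
rewrite len// -EFinM lee_fin /q; case: ifP => _; last by rewrite mul0r.
by rewrite big_ord_recl mulrC.
Qed.

Section lebesgue_outer.
Context (R : realType) (m : nat).
Let V := 'rV[R]_m.+1.
Let adm (j : V * V) := forall i, j.1 ord0 i <= j.2 ord0 i.
Let vol (j : V * V) : \bar R := (\prod_(i < m.+1) (j.2 ord0 i - j.1 ord0 i))%:E.

Let vol_ge0 j : adm j -> (0 <= vol j)%E.
Proof. by move=> aj; rewrite lee_fin; apply: prodr_ge0 => i _; rewrite subr_ge0. Qed.

Let vol_triv : exists2 j, adm j & vol j = 0%E.
Proof.
exists (0, 0); first by move=> i.
by rewrite /vol big_ord_recl subrr mul0r.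
Qed.

Lemma lebesgue_outer0 : lebesgue_outer (set0 : set V) = 0%E.
Proof. exact: (cover_outer0 (fun j => box j.1 j.2) vol_ge0 vol_triv). Qed.

Lemma lebesgue_outer_ge0 (X : set V) : (0 <= lebesgue_outer X)%E.
Proof. exact: (cover_outer_ge0 (fun j => box j.1 j.2) vol_ge0). Qed.

Lemma le_lebesgue_outer :
  {homo @lebesgue_outer R m.+1 : X Y / X `<=` Y >-> (X <= Y)%E}.
Proof. exact: (@le_cover_outer _ _ _ adm (fun j => box j.1 j.2) vol). Qed.

Lemma lebesgue_outer_sigma_subadditive :
  sigma_subadditive (@lebesgue_outer R m.+1).
Proof. exact: (@cover_outer_sigma_subadditive _ _ _ adm (fun j => box j.1 j.2) vol vol_ge0). Qed.

HB.instance Definition _ := isOuterMeasure.Build R V (@lebesgue_outer R m.+1)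
  lebesgue_outer0 lebesgue_outer_ge0 le_lebesgue_outer
  lebesgue_outer_sigma_subadditive.

Lemma lebesgue_outer_le_box (a b : V) (X : set V) :
  (forall i, a ord0 i <= b ord0 i) -> X `<=` box a b ->
  (lebesgue_outer X <= (\prod_(i < m.+1) (b ord0 i - a ord0 i))%:E)%E.
Proof. move=> ab Xab.
exact: (@cover_outer_le1 _ _ _ adm (fun j => box j.1 j.2) vol vol_ge0 vol_triv (a, b)). Qed.

Lemma lebesgue_outer_ge_box (a b : V) :
  (forall i, a ord0 i <= b ord0 i) ->
  ((\prod_(i < m.+1) (b ord0 i - a ord0 i))%:E <= lebesgue_outer (box a b))%E.
Proof.
move=> ab; apply: le_ereal_inf_tmp => _ [I [admI cov] <-].
apply: (@box_volume_le_cover _ _ _ _ (fun k i => (I k).1 ord0 i)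
   (fun k i => (I k).2 ord0 i) xpredT) => // x xab.
have [|k _ Bk] := cov (\row_i x i); first by move=> i; rewrite mxE.
by exists k => // i; have := Bk i; rewrite mxE.
Qed.

Lemma lebesgue_outer_scale_le (r : R) (X : set V) : 0 < r ->
  (lebesgue_outer [set r *: x | x in X] <= (r ^+ m.+1)%:E * lebesgue_outer X)%E.
Proof.
move=> r0; rewrite -lee_pdivrMl ?exprn_gt0//.
apply: le_ereal_inf_tmp => _ [I [admI cov] <-].
rewrite lee_pdivrMl ?exprn_gt0// -nneseriesZl//; last by move=> k _; exact: vol_ge0.
pose rI k : V * V := (r *: (I k).1, r *: (I k).2).
apply: (@le_trans _ _ (\sum_(0 <= k <oo) vol (rI k))%E).
  apply: (@cover_outer_le_sum _ _ _ adm (fun j => box j.1 j.2) vol rI).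
  - by move=> k i; rewrite !mxE ler_pM2l//; exact: admI.
  - move=> _ [x /cov[k _ Bk] <-]; exists k => // i /=; rewrite !mxE !ler_pM2l//.
apply: lee_nneseries => k _.
  by move=> _; apply: vol_ge0 => i; rewrite !mxE ler_pM2l//; exact: admI.
rewrite /vol -EFinM lee_fin; under eq_bigr do rewrite !mxE -mulrBr.
by rewrite big_split/= prodr_const card_ord.
Qed.

Lemma lebesgue_outer_scale (r : R) (X : set V) : 0 < r ->
  (lebesgue_outer [set r *: x | x in X] = (r ^+ m.+1)%:E * lebesgue_outer X)%E.
Proof.
move=> r0; apply/eqP; rewrite eq_le lebesgue_outer_scale_le//=.
rewrite -lee_pdivlMl ?exprn_gt0//.
have r'0 : 0 < r^-1 by rewrite invr_gt0.
apply: le_trans (le_trans _ (lebesgue_outer_scale_le [set r *: x | x in X] r'0)) _.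
  apply: le_lebesgue_outer => x Xx; exists (r *: x); first by exists x.
  by rewrite scalerA mulVf ?gt_eqF// scale1r.
by rewrite exprVn.
Qed.

(** The hyperplane cuts every box of a cover into two boxes whose volumes add up, so a cover of [X]
    yields covers of both parts of [X] at the same total cost. *)
Lemma halfspace_caratheodory (i : 'I_m.+1) (c : R) :
  (@lebesgue_outer R m.+1).-caratheodory [set x : V | c <= x ord0 i].
Proof.
apply: le_caratheodory_measurable => X.
apply: le_ereal_inf_tmp => _ [I [admI cov] <-].
(* [mid k] is [c] clamped to the [i]-th edge of the box; a box on one side of the hyperplane gets a
   degenerate second half. *)
pose mid k := Num.max ((I k).1 ord0 i) (Num.min c ((I k).2 ord0 i)).
have midP k : (I k).1 ord0 i <= mid k <= (I k).2 ord0 i.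
  by rewrite /mid le_max lexx/= ge_max admI/= ge_min lexx orbT.
pose upd (v : V) (t : R) : V := \row_j (if j == i then t else v ord0 j).
have updE (a b : V) u v : \prod_j (upd b v ord0 j - upd a u ord0 j) =
    (v - u) * \prod_(j | j != i) (b ord0 j - a ord0 j).
  rewrite (bigD1 i)//= !mxE eqxx; congr (_ * _).
  by apply: eq_bigr => j /negbTE ji; rewrite !mxE ji.
have upd_id (v : V) : upd v (v ord0 i) = v.
  by apply/rowP => j; rewrite mxE; case: eqP => // ->.
pose up k : V * V := (upd (I k).1 (mid k), (I k).2).
pose lo k : V * V := ((I k).1, upd (I k).2 (mid k)).
have adm_up k : adm (up k).
  by move=> j; rewrite !mxE; case: eqP => [->|_]; [case/andP: (midP k)|exact: admI].
have adm_lo k : adm (lo k).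
  by move=> j; rewrite !mxE; case: eqP => [->|_]; [case/andP: (midP k)|exact: admI].
have -> : (\sum_(0 <= k <oo) vol (I k) =
    \sum_(0 <= k <oo) vol (up k) + \sum_(0 <= k <oo) vol (lo k))%E.
  rewrite -nneseriesD; last 2 first.
  - by move=> k _ _; exact: vol_ge0.
  - by move=> k _ _; exact: vol_ge0.
  apply: eq_eseriesr => k _; rewrite -EFinD; congr EFin.
  rewrite /up /lo /= -{2}[(I k).2]upd_id -{3}[(I k).1]upd_id !updE -mulrDl addrA.
  by rewrite subrK -updE !upd_id.
apply: leeD.
  apply: (@cover_outer_le_sum _ _ _ adm (fun j => box j.1 j.2) vol up) => // x.
  move=> [/cov[k _ Bk] /= xc]; exists k => // j /=; rewrite mxE.
  case: eqP => [->|_]; last exact: Bk.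
  have /andP[xl xr] := Bk i.
  by rewrite xr andbT ge_max xl ge_min xc.
apply: (@cover_outer_le_sum _ _ _ adm (fun j => box j.1 j.2) vol lo) => // x.
move=> [/cov[k _ Bk] /= xc]; exists k => // j /=; rewrite mxE.
case: eqP => [->|_]; last exact: Bk.
have /andP[xl xr] := Bk i.
rewrite xl/= le_max le_min xr; have /negP := xc; rewrite -ltNge => /ltW ->.
by rewrite orbT.
Qed.

(** Half-spaces make the coordinates measurable for the Carathéodory sigma-algebra, hence also the
    sum of their squares, of which the ball is a sublevel set. *)
Lemma eball_caratheodory (r : R) : (@lebesgue_outer R m.+1).-caratheodory (eball r).
Proof.
pose T := caratheodory_type (@lebesgue_outer R m.+1).
have coord i : measurable_fun [set: T] (fun x : V => x ord0 i).
  apply: (measurability _ (RGenCInfty.measurableE R)) => _ [_ [c ->] <-].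
  rewrite setTI.
  have -> : (fun x : V => x ord0 i) @^-1` `[c, +oo[ = [set x : V | c <= x ord0 i].
    by apply/seteqP; split => x; rewrite /= in_itv/= andbT.
  exact: halfspace_caratheodory.
(* Comparing squares is legitimate only for [r >= 0]; for negative [r] the ball is empty. *)
have [r0|r0] := ltP r 0.
  have -> : eball r = set0 :> set V.
    apply/seteqP; split => // x /= xr.
    by have := le_lt_trans xr r0; rewrite ltNge sqrtr_ge0.
  exact: caratheodory_measurable_set0.
have mf : measurable_fun [set: T] (fun x : V => \sum_i x ord0 i ^+ 2).
  by apply: measurable_sum => i; exact: measurable_funX.
have := mf measurableT `]-oo, r ^+ 2]%classic (measurable_itv _).
rewrite setTI; congr (_.-caratheodory _).
apply/seteqP; split => x; rewrite /= in_itv/= => h.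
  rewrite -(ger0_norm r0) -sqrtr_sqr; exact: ler_wsqrtr.
rewrite -(@ler_sqrt _ _ (r ^+ 2)) ?sqr_ge0//.
by rewrite sqrtr_sqr (ger0_norm r0).
Qed.

End lebesgue_outer.

(** * Euclidean norm and Hausdorff measure *)

Section enorm.
Context (R : realType) (n : nat).
Implicit Types x y z : 'rV[R]_n.

Lemma enorm_ge0 x : 0 <= enorm x.
Proof. exact: sqrtr_ge0. Qed.

Lemma enorm_sqr x : enorm x ^+ 2 = \sum_(i < n) x ord0 i ^+ 2.
Proof. by rewrite sqr_sqrtr//; apply: sumr_ge0 => i _; exact: sqr_ge0. Qed.

Lemma enormZ (r : R) x : enorm (r *: x) = `|r| * enorm x.
Proof.
rewrite /enorm; under eq_bigr do rewrite mxE exprMn.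
by rewrite -mulr_sumr sqrtrM ?sqr_ge0// sqrtr_sqr.
Qed.

Lemma enorm0 : enorm (0 : 'rV[R]_n) = 0.
Proof. by rewrite -(scale0r 0) enormZ normr0 mul0r. Qed.

Lemma enormN x : enorm (- x) = enorm x.
Proof. by rewrite -scaleN1r enormZ normrN1 mul1r. Qed.

Lemma le_coord_enorm x i : `|x ord0 i| <= enorm x.
Proof.
rewrite -sqrtr_sqr ler_wsqrtr// (bigD1 i)//= lerDl.
by apply: sumr_ge0 => j _; exact: sqr_ge0.
Qed.

Lemma enorm_le_sup x (c : R) : (forall i, `|x ord0 i| <= c) -> enorm x <= n%:R * c.
Proof.
case: n x => [|k] x xc; first by rewrite /enorm big_ord0 sqrtr0 mul0r.
have c0 : 0 <= c := le_trans (normr_ge0 _) (xc ord0).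
rewrite -(ger0_norm (_ : 0 <= k.+1%:R * c)) ?mulr_ge0// -sqrtr_sqr ler_wsqrtr//.
apply: (@le_trans _ _ (\sum_(i < k.+1) c ^+ 2)).
  by apply: ler_sum => i _; rewrite -real_normK ?num_real// ler_sqr ?nnegrE.
rewrite sumr_const card_ord exprMn -[leLHS]mulr_natl ler_wpM2r ?sqr_ge0//.
by rewrite -natrX ler_nat leq_pmull.
Qed.

(** Cauchy-Schwarz: the squares of x_i |y| - y_i |x| add up to 2 |x||y| (|x||y| - x.y), and the
    positive factor is cancelled once the cases of zero norm are set aside. *)
Lemma ler_dot_enorm x y : \sum_(i < n) x ord0 i * y ord0 i <= enorm x * enorm y.
Proof.
have [x0|x0] := eqVneq (enorm x) 0.
  rewrite x0 mul0r big1// => i _; have := le_coord_enorm x i.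
  by rewrite x0 normr_le0 => /eqP ->; rewrite mul0r.
have [y0|y0] := eqVneq (enorm y) 0.
  rewrite y0 mulr0 big1// => i _; have := le_coord_enorm y i.
  by rewrite y0 normr_le0 => /eqP ->; rewrite mulr0.
have xy0 : 0 < enorm x * enorm y by rewrite mulr_gt0// lt0r enorm_ge0 ?x0 ?y0.
rewrite -(ler_pM2l xy0).
have : 0 <= \sum_(i < n) (x ord0 i * enorm y - y ord0 i * enorm x) ^+ 2.
  by apply: sumr_ge0 => i _; exact: sqr_ge0.
have -> : \sum_(i < n) (x ord0 i * enorm y - y ord0 i * enorm x) ^+ 2 =
   2 * ((enorm x * enorm y) * (enorm x * enorm y) -
        enorm x * enorm y * \sum_(i < n) x ord0 i * y ord0 i).
  transitivity (\sum_(i < n) (enorm y ^+ 2 * x ord0 i ^+ 2 + enorm x ^+ 2 * y ord0 i ^+ 2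
      - 2 * (enorm x * enorm y) * (x ord0 i * y ord0 i))).
    by apply: eq_bigr => i _; ring.
  rewrite sumrB big_split/= -!mulr_sumr -!enorm_sqr; ring.
by rewrite pmulr_rge0// subr_ge0.
Qed.

Lemma ler_enormD x y : enorm (x + y) <= enorm x + enorm y.
Proof.
rewrite -(@ler_pXn2r _ 2)// ?nnegrE ?addr_ge0 ?enorm_ge0//.
have -> : enorm (x + y) ^+ 2 =
    enorm x ^+ 2 + enorm y ^+ 2 + 2 * \sum_(i < n) x ord0 i * y ord0 i.
  rewrite !enorm_sqr mulr_sumr -!big_split/=; apply: eq_bigr => i _.
  by rewrite mxE; ring.
have := ler_dot_enorm x y; nra.
Qed.

Lemma ler_enorm_sub x y : enorm x - enorm y <= enorm (x - y).
Proof. by rewrite lerBlDr (le_trans _ (ler_enormD _ _))// subrK. Qed.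

End enorm.

(** Neighbourhoods come from the sup norm; a sup ball of radius [e / 2 / n.+1] fits inside the
    Euclidean one, the halving making the inequality strict. *)
Lemma nbhs_enorm (R : realType) (n : nat) (x : 'rV[R]_n.+1) (e : R) :
  0 < e -> nbhs x [set y | enorm (x - y) < e].
Proof.
move=> e0; have e'0 : 0 < e / 2 / n.+1%:R by rewrite !divr_gt0.
apply/nbhs_ballP; exists (e / 2 / n.+1%:R) => //= y; rewrite -ball_normE/= => xy.
apply: (@le_lt_trans _ _ (e / 2)); last by lra.
have -> : e / 2 = n.+1%:R * (e / 2 / n.+1%:R) by rewrite [RHS]mulrC divfK.
apply: enorm_le_sup => i; apply: le_trans (ltW xy).
by rewrite [leRHS]/Num.norm/= mx_normrE; apply/bigmax_geP; right; exists (ord0, i).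
Qed.

Section ediam.
Context (R : realType) (n : nat).
Implicit Types E : set 'rV[R]_n.

Lemma ediam_ge0 E : E !=set0 -> (0 <= ediam E)%E.
Proof.
move=> [x Ex]; apply: ereal_sup_ubound; exists x => //; exists x => //.
by rewrite subrr enorm0.
Qed.

Lemma ediam_le E (d : R) :
  (forall x y, E x -> E y -> enorm (x - y) <= d) -> (ediam E <= d%:E)%E.
Proof.
by move=> Ed; apply: ge_ereal_sup => _ [x Ex] [y Ey] <-; rewrite lee_fin; exact: Ed.
Qed.

Lemma enorm_le_ediam E (d : R) x y :
  (ediam E <= d%:E)%E -> E x -> E y -> enorm (x - y) <= d.
Proof.
move=> Ed Ex Ey; rewrite -lee_fin; apply: le_trans Ed.
by apply: ereal_sup_ubound; exists x => //; exists y.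
Qed.

Lemma unit_ball_volume_ge0 m : 0 <= unit_ball_volume R m.
Proof.
(* The recurrence goes back two steps, so the induction carries two consecutive values. *)
suff : 0 <= unit_ball_volume R m /\ 0 <= unit_ball_volume R m.+1 by case.
elim: m => [|m [h1 h2]]; first by split.
by split => //=; rewrite mulr_ge0// divr_ge0// mulr_ge0// pi_ge0.
Qed.

Lemma hausdorff_gauge_ge0 m E : (0 <= hausdorff_gauge m E)%E.
Proof.
rewrite /hausdorff_gauge; case: eqP => // /eqP/set0P/ediam_ge0 E0.
rewrite mule_ge0//; last exact: expe_ge0.
by rewrite lee_fin divr_ge0 ?unit_ball_volume_ge0.
Qed.

Lemma hausdorff_gauge0 m : hausdorff_gauge m (set0 : set 'rV[R]_n) = 0%E.
Proof. by rewrite /hausdorff_gauge eqxx. Qed.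

Lemma hausdorff_gauge_le m E (d : R) : 0 <= d -> (ediam E <= d%:E)%E ->
  (hausdorff_gauge m E <= (unit_ball_volume R m / 2 ^+ m * d ^+ m)%:E)%E.
Proof.
move=> d0 Ed; have c0 : 0 <= unit_ball_volume R m / 2 ^+ m.
  by rewrite divr_ge0 ?unit_ball_volume_ge0.
rewrite /hausdorff_gauge; case: eqP => [_|/eqP/set0P/ediam_ge0 E0].
  by rewrite lee_fin mulr_ge0// exprn_ge0.
rewrite [leRHS]EFinM lee_wpmul2l ?lee_fin// EFin_expe.
elim: m {c0} => [//|m IH]; rewrite !expeS; apply: lee_pmul => //.
exact: expe_ge0.
Qed.

End ediam.

Section hausdorff.
Local Open Scope ereal_scope.
Context (R : realType) (n m : nat).
Let V := 'rV[R]_n.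
Implicit Types X Y : set V.

Let adm (d : R) (E : set V) := ediam E <= d%:E.
Let gauge (E : set V) := hausdorff_gauge m E.

Let gauge_ge0 d E : adm d E -> 0 <= gauge E.
Proof. by move=> _; exact: hausdorff_gauge_ge0. Qed.

Let gauge_triv d : exists2 E, adm d E & gauge E = 0.
Proof.
exists set0; last exact: hausdorff_gauge0.
rewrite /adm /ediam; apply: ge_ereal_sup => _ [x []].
Qed.

Lemma hausdorff_delta0 d : hausdorff_delta m d (set0 : set V) = 0.
Proof. exact: (cover_outer0 id (@gauge_ge0 d) (gauge_triv d)). Qed.

Lemma hausdorff_delta_ge0 d X : 0 <= hausdorff_delta m d X.
Proof. exact: (cover_outer_ge0 id (@gauge_ge0 d)). Qed.

Lemma le_hausdorff_delta d X Y :
  X `<=` Y -> hausdorff_delta m d X <= hausdorff_delta m d Y.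
Proof. exact: (@le_cover_outer _ _ _ (adm d) id gauge). Qed.

Lemma hausdorff_delta_antitone (d e : R) X : (d <= e)%R ->
  hausdorff_delta m e X <= hausdorff_delta m d X.
Proof.
move=> de; apply: ereal_inf_le_tmp => _ [E [admE XE] <-]; exists E => //; split => // k.
by apply: le_trans (admE k) _; rewrite lee_fin.
Qed.

Lemma hausdorff_deltaU d X Y :
  hausdorff_delta m d (X `|` Y) <= hausdorff_delta m d X + hausdorff_delta m d Y.
Proof.
apply: sigma_subadditiveU; first exact: hausdorff_delta0.
  exact: hausdorff_delta_ge0.
exact: (@cover_outer_sigma_subadditive _ _ _ (adm d) id gauge (@gauge_ge0 d)).
Qed.

Lemma hausdorff_delta_le_gauge d X :
  ediam X <= d%:E -> hausdorff_delta m d X <= hausdorff_gauge m X.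
Proof.
move=> Xd.
exact: (@cover_outer_le1 _ _ _ (adm d) id gauge (@gauge_ge0 d) (gauge_triv d) X).
Qed.

Lemma hausdorff_delta_le_hausdorff (d : R) X :
  (0 < d)%R -> hausdorff_delta m d X <= hausdorff m X.
Proof. by move=> d0; apply: ereal_sup_ubound; exists d. Qed.

Lemma hausdorff_ge0 X : 0 <= hausdorff m X.
Proof.
exact: le_trans (hausdorff_delta_ge0 1 X) (hausdorff_delta_le_hausdorff X ltr01).
Qed.

Lemma hausdorff0 : hausdorff m (set0 : set V) = 0.
Proof.
apply/eqP; rewrite eq_le hausdorff_ge0 andbT.
by apply: ge_ereal_sup => _ [d _ <-]; rewrite hausdorff_delta0.
Qed.

Lemma le_hausdorff X Y : X `<=` Y -> hausdorff m X <= hausdorff m Y.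
Proof.
move=> XY; apply: ge_ereal_sup => _ [d d0 <-].
exact: le_trans (le_hausdorff_delta d XY) (hausdorff_delta_le_hausdorff _ d0).
Qed.

Lemma hausdorffU X Y : hausdorff m (X `|` Y) <= hausdorff m X + hausdorff m Y.
Proof.
apply: ge_ereal_sup => _ [d d0 <-]; apply: le_trans (hausdorff_deltaU d X Y) _.
by apply: leeD; exact: hausdorff_delta_le_hausdorff.
Qed.

Lemma hausdorff_delta_bigsetU (I : Type) (s : seq I) (F : I -> set V) d :
  hausdorff_delta m d (\big[setU/set0]_(i <- s) F i) <=
  \sum_(i <- s) hausdorff_delta m d (F i).
Proof.
elim: s => [|i s IH]; first by rewrite !big_nil hausdorff_delta0.
by rewrite !big_cons; apply: le_trans (hausdorff_deltaU _ _ _) _; exact: leeD.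
Qed.

Lemma hausdorff_bigsetU (I : Type) (s : seq I) (F : I -> set V) :
  hausdorff m (\big[setU/set0]_(i <- s) F i) <= \sum_(i <- s) hausdorff m (F i).
Proof.
elim: s => [|i s IH]; first by rewrite !big_nil hausdorff0.
by rewrite !big_cons; apply: le_trans (hausdorffU _ _) _; exact: leeD.
Qed.

(** Sets of diameter less than [g] cannot meet both [X] and [Y], so a fine cover of the union splits
    into a cover of each without sharing a set. *)
Lemma hausdorff_metric_additive X Y (g : R) : (0 < g)%R ->
  (forall x y, X x -> Y y -> g <= enorm (x - y))%R ->
  hausdorff m X + hausdorff m Y <= hausdorff m (X `|` Y).
Proof.
move=> g0 gXY.
have sep (d : R) : (0 < d)%R -> (d < g)%R ->
    hausdorff_delta m d X + hausdorff_delta m d Y <= hausdorff m (X `|` Y).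
  move=> d0 dg; apply: le_trans _ (hausdorff_delta_le_hausdorff _ d0).
  apply: le_ereal_inf_tmp => _ [E [admE cov] <-].
  (* Sets that miss [Z] become empty and so have gauge 0. *)
  pose restr (Z : set V) k := if pselect (E k `&` Z !=set0) then E k else set0.
  have le_restr Z : Z `<=` X `|` Y ->
      hausdorff_delta m d Z <= \sum_(0 <= k <oo) gauge (restr Z k).
    move=> ZXY; apply: (@cover_outer_le_sum _ _ _ (adm d) id gauge (restr Z)).
      rewrite /restr => k; case: pselect => ?; first exact: admE.
      by rewrite /adm; apply: ge_ereal_sup => _ [x []].
    move=> x Zx; have [k _ Ekx] := cov x (ZXY _ Zx); exists k => //.
    by rewrite /restr; case: pselect => // -[]; exists x.
  apply: le_trans (leeD (le_restr _ (@subsetUl _ X Y)) (le_restr _ (@subsetUr _ X Y))) _.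
  rewrite -nneseriesD; last 2 first.
  - by move=> k _ _; exact: hausdorff_gauge_ge0.
  - by move=> k _ _; exact: hausdorff_gauge_ge0.
  apply: lee_nneseries => k _.
    by move=> _; apply: adde_ge0; exact: hausdorff_gauge_ge0.
  rewrite /restr; case: pselect => [EX|?].
    case: pselect => [EY|?].
      have [x [Ex Xx]] := EX; have [y [Ey Yy]] := EY.
      have := enorm_le_ediam (admE k) Ex Ey.
      by rewrite leNgt (lt_le_trans dg (gXY _ _ Xx Yy)).
    by rewrite /gauge hausdorff_gauge0 adde0.
  case: pselect => ?; rewrite /gauge hausdorff_gauge0 add0e//.
  exact: hausdorff_gauge_ge0.
have hXoo : hausdorff m X <= hausdorff m (X `|` Y) by apply: le_hausdorff; exact: subsetUl.
have [->|XYoo] := eqVneq (hausdorff m (X `|` Y)) +oo; first by rewrite leey.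
have XYfin : hausdorff m (X `|` Y) \is a fin_num.
  by rewrite ge0_fin_numE ?hausdorff_ge0// lt_neqAle XYoo leey.
have Xfin : hausdorff m X \is a fin_num.
  rewrite ge0_fin_numE ?hausdorff_ge0//; apply: le_lt_trans hXoo _.
  by rewrite -ge0_fin_numE ?hausdorff_ge0.
have dfin d : (0 < d)%R -> hausdorff_delta m d Y \is a fin_num.
  move=> d0; rewrite ge0_fin_numE ?hausdorff_delta_ge0//.
  apply: le_lt_trans (hausdorff_delta_le_hausdorff _ d0) _.
  apply: (@le_lt_trans _ _ (hausdorff m (X `|` Y))).
    by apply: le_hausdorff; exact: subsetUr.
  by rewrite -ge0_fin_numE ?hausdorff_ge0.
(* Finiteness lets each term be moved across by subtraction, so that the two suprema are taken one
   after the other, over independent [d] and [e]. *)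
rewrite addeC -leeBrDr//; apply: ge_ereal_sup => _ [d /= d0 <-].
rewrite leeBrDr// addeC -leeBrDr ?dfin//; apply: ge_ereal_sup => _ [e /= e0 <-].
rewrite leeBrDr ?dfin//.
pose c := Num.min (Num.min d e) (g / 2)%R.
have c0 : (0 < c)%R by rewrite !lt_min d0 e0 divr_gt0.
have cg : (c < g)%R by rewrite gt_min; apply/orP; right; lra.
apply: le_trans (sep c c0 cg); apply: leeD; apply: hausdorff_delta_antitone.
  by rewrite !ge_min lexx orbT.
by rewrite !ge_min lexx.
Qed.

End hausdorff.

(** * Area bound for Euclidean spheres *)

Section sphere.
Context (R : realType) (m : nat).
Let V := 'rV[R]_m.+1.

Lemma grid_cell (s t : R) (N : nat) : 0 < s -> - s <= t <= s ->
  exists q : 'I_N.+1, - s + q%:R * (2 * s / N.+1%:R) <= t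
                    <= - s + q.+1%:R * (2 * s / N.+1%:R).
Proof.
move=> s0 /andP[t1 t2]; pose h := 2 * s / N.+1%:R.
have h0 : 0 < h by rewrite divr_gt0// mulr_gt0.
have Nh : N.+1%:R * h = 2 * s by rewrite /h mulrC divfK.
pose z := (t + s) / h.
have z0 : 0 <= z by rewrite divr_ge0 ?(ltW h0)//; lra.
have zh : z * h = t + s by rewrite /z divfK// gt_eqF.
have /andP[q1 q2] := truncn_itv z0.
(* At [t = s] the quotient [z] is [N.+1]; the minimum assigns that endpoint to the last cell. *)
exists (inord (minn (Num.truncn z) N)).
rewrite inordK ?ltnS ?geq_minr// -/h.
have lo : (minn (Num.truncn z) N)%:R <= z.
  by apply: le_trans q1; rewrite ler_nat geq_minl.
have hi : z <= (minn (Num.truncn z) N).+1%:R.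
  rewrite /minn; case: ltnP => _; first exact: ltW.
  by rewrite -(ler_pM2r h0) zh Nh; lra.
by rewrite -(ler_pM2r h0) zh in lo; rewrite -(ler_pM2r h0) zh in hi; apply/andP; split; lra.
Qed.

(* On the cap where the [i]-th coordinate dominates, that coordinate is a
   1-Lipschitz function of the others for the l^1 distance. *)
Lemma cap_coord_le (x y : V) (i : 'I_m.+1) (h : R) :
  enorm x = enorm y -> 0 <= x ord0 i * y ord0 i ->
  (forall j, `|x ord0 j| <= `|x ord0 i|) -> (forall j, `|y ord0 j| <= `|y ord0 i|) ->
  (forall j, j != i -> `|x ord0 j - y ord0 j| <= h) ->
  `|x ord0 i - y ord0 i| <= m%:R * h.
Proof.
move=> exy sg xi yi xyh.
set X := `|x ord0 i|; set Y := `|y ord0 i|.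
have X0 : 0 <= X by exact: normr_ge0.
have Y0 : 0 <= Y by exact: normr_ge0.
have sumh : \sum_(j | j != i) `|x ord0 j - y ord0 j| <= m%:R * h.
  apply: (@le_trans _ _ (\sum_(j | j != i) h)); first exact: ler_sum.
  rewrite sumr_const; have -> : #|[pred j | j != i]| = m.
    by have := cardC1 i; rewrite card_ord.
  by rewrite mulr_natl.
have [XY|XY] := eqVneq (X + Y) 0.
  have /eqP : X = 0 by lra.
  have /eqP : Y = 0 by lra.
  rewrite !normr_eq0 => /eqP -> /eqP ->; rewrite subrr normr0.
  by apply: le_trans sumh; apply: sumr_ge0.
have XYpos : 0 < X + Y by rewrite lt_neqAle eq_sym XY addr_ge0.
rewrite -(ler_pM2r XYpos).
(* Since the signs agree, multiplying by [X + Y] gives a difference of squares. Equal norms turn it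
   into a sum over the other coordinates, where dominance bounds each [y j + x j] by [X + Y], which
   then cancels. *)
have -> : `|x ord0 i - y ord0 i| * (X + Y) = `|x ord0 i ^+ 2 - y ord0 i ^+ 2|.
  rewrite subr_sqr normrM; congr (_ * _); rewrite /X /Y.
  have [x0|x0] := ger0P (x ord0 i); have [y0|y0] := ger0P (y ord0 i);
    have [xy0|xy0] := ger0P (x ord0 i + y ord0 i); nra.
have -> : x ord0 i ^+ 2 - y ord0 i ^+ 2 =
    \sum_(j | j != i) (y ord0 j - x ord0 j) * (y ord0 j + x ord0 j).
  have := congr1 (fun t => t ^+ 2) exy; rewrite /= !enorm_sqr (bigD1 i)//= [RHS](bigD1 i)//=.
  have -> : \sum_(j | j != i) (y ord0 j - x ord0 j) * (y ord0 j + x ord0 j) =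
      \sum_(j | j != i) y ord0 j ^+ 2 - \sum_(j | j != i) x ord0 j ^+ 2.
    by rewrite -sumrB; apply: eq_bigr => j _; rewrite subr_sqr.
  by lra.
apply: le_trans (ler_norm_sum _ _ _) _.
apply: (@le_trans _ _ (\sum_(j | j != i) `|x ord0 j - y ord0 j| * (X + Y))).
  apply: ler_sum => j ji; rewrite normrM [`|y ord0 j - _|]distrC ler_wpM2l//.
  by rewrite addrC; apply: le_trans (ler_normD _ _) (lerD (xi j) (yi j)).
by rewrite -mulr_suml ler_wpM2r// ltW.
Qed.

(** The index records a dominant coordinate, its sign and the grid cell of the other coordinates.
    Fixing the sign keeps opposite points of the sphere apart. *)
Let cap (s : R) (N : nat) (k : 'I_m.+1 * bool * {ffun 'I_m -> 'I_N.+1}) : set V :=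
  [set x | [/\ enorm x = s,
     0 <= (-1) ^+ (k.1.2 : bool) * x ord0 k.1.1,
     forall j, `|x ord0 j| <= `|x ord0 k.1.1| &
     forall j, - s + (k.2 j)%:R * (2 * s / N.+1%:R) <= x ord0 (lift k.1.1 j)
            <= - s + (k.2 j).+1%:R * (2 * s / N.+1%:R)]].

Let cap_ediam s N k : 0 < s ->
  (ediam (@cap s N k) <= (m.+1%:R * (m.+1%:R * (2 * s / N.+1%:R)))%:E)%E.
Proof.
case: k => [[i b] q] s0; set h := 2 * s / N.+1%:R.
have h0 : 0 <= h by rewrite divr_ge0// mulr_ge0// ltW.
apply: ediam_le => x y /= [xs xb xi xq] [ys yb yi yq].
have other j : j != i -> `|x ord0 j - y ord0 j| <= h.
  move=> ji; have [|j' ->] := @unlift_some _ i j; first by rewrite eq_sym.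
  move=> _; move: (xq j') (yq j') => /= /andP[x1 x2] /andP[y1 y2].
  rewrite -/h -natr1 mulrDl mul1r in x1 x2; rewrite -/h -natr1 mulrDl mul1r in y1 y2.
  by rewrite ler_norml; apply/andP; split; lra.
apply: enorm_le_sup => j; rewrite !mxE.
have [->|ji] := eqVneq j i.
  apply: (@le_trans _ _ (m%:R * h)).
    apply: cap_coord_le => //; first by rewrite xs ys.
    rewrite -[_ * _]mul1r -(sqrr_sign R b) expr2 mulrACA.
    exact: mulr_ge0.
  by rewrite ler_wpM2r// ler_nat.
by apply: le_trans (other j ji) _; rewrite ler_peMl// ler1n.
Qed.

Let cap_cover s N : 0 < s ->
  [set x : V | enorm x = s] `<=` \big[setU/set0]_k (@cap s N k).
Proof.
move=> s0 x /= xs.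
have [i _ xi] := @arg_maxP _ R 'I_m.+1 ord0 xpredT (fun j => `|x ord0 j|) isT.
have cell (j : 'I_m) : exists q : 'I_N.+1,
    - s + q%:R * (2 * s / N.+1%:R) <= x ord0 (lift i j)
      <= - s + q.+1%:R * (2 * s / N.+1%:R).
  apply: grid_cell => //.
  by have := le_coord_enorm x (lift i j); rewrite xs ler_norml.
have [q qP] := choice cell.
rewrite -bigcup_seq; exists (i, x ord0 i < 0, [ffun j => q j]); first exact: mem_index_enum.
split => //=.
- have [x0|x0] := ltP (x ord0 i) 0; first by rewrite expr1 mulN1r oppr_ge0 ltW.
  by rewrite expr0 mul1r.
- by move=> j; exact: xi.
- by move=> j; rewrite ffunE.
Qed.

(** There are 2 (m+1) (N+1)^m caps, each of diameter at most c s / (N+1). The resulting sum of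
    gauges is independent of [N], while the diameters become arbitrarily small. *)
Lemma hausdorff_sphere_le : exists2 C : R, 0 <= C & forall s, 0 < s ->
  (hausdorff m [set x : V | enorm x = s] <= (C * s ^+ m)%:E)%E.
Proof.
pose w : R := unit_ball_volume R m / 2 ^+ m.
have w0 : 0 <= w by rewrite divr_ge0 ?unit_ball_volume_ge0.
pose c : R := m.+1%:R * (m.+1%:R * 2).
have c0 : 0 <= c by rewrite !mulr_ge0.
exists (m.+1%:R * 2 * w * c ^+ m); first by rewrite mulr_ge0 ?exprn_ge0// mulr_ge0.
move=> s s0; apply: ge_ereal_sup => _ [d /= d0 <-].
have [N Nd] : exists N : nat, c * s / d < N.+1%:R.
  by exists (Num.truncn (c * s / d)); exact: truncnS_gt.
pose e : R := m.+1%:R * (m.+1%:R * (2 * s / N.+1%:R)).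
have eE : e = c * s / N.+1%:R by rewrite /e /c; ring.
have e0 : 0 <= e by rewrite eE divr_ge0// mulr_ge0// ltW.
have ed : e <= d.
  by rewrite eE ler_pdivrMr// [leRHS]mulrC -ler_pdivrMr// ltW.
apply: le_trans (le_hausdorff_delta _ _ (@cap_cover s N s0)) _.
apply: le_trans (hausdorff_delta_bigsetU _ _ _ _) _.
apply: (@le_trans _ _ (\sum_(k : 'I_m.+1 * bool * {ffun 'I_m -> 'I_N.+1})
    (w * e ^+ m)%:E)%E).
  apply: lee_sum => k _; apply: le_trans (hausdorff_delta_le_gauge _ _) _.
    by apply: le_trans (cap_ediam k s0) _; rewrite lee_fin.
  exact: hausdorff_gauge_le (cap_ediam k s0).
rewrite sumEFin lee_fin sumr_const !card_prod card_ffun !card_ord card_bool.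
rewrite -[leLHS]mulr_natl !natrM natrX eE !exprMn exprVn.
rewrite le_eqVlt; apply/orP; left; apply/eqP; field.
by rewrite expf_neq0// pnatr_eq0.
Qed.

End sphere.

(** * Volumes of balls and shells *)

Section ball_volume.
Context (R : realType) (m : nat).
Let V := 'rV[R]_m.+1.
Local Notation lam := (@lebesgue_outer R m.+1).

Definition omega : R := fine (lam (eball 1)).

Lemma eball1_volume : lam (eball 1) = omega%:E.
Proof.
rewrite fineK// ge0_fin_numE ?lebesgue_outer_ge0//.
apply: le_lt_trans (lebesgue_outer_le_box (a := const_mx (-1)) (b := const_mx 1) _ _) _.
- by move=> i; rewrite !mxE; lra.
- move=> x /= x1 i; rewrite !mxE -ler_norml; exact: le_trans (le_coord_enorm x i) x1.
- exact: ltry.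
Qed.

Lemma omega_gt0 : 0 < omega.
Proof.
rewrite -lte_fin -eball1_volume.
(* By [enorm_le_sup] a cube with this side and a corner at the origin lies in the unit ball. *)
have c0 : 0 < m.+1%:R^-1 :> R by rewrite invr_gt0.
apply: (@lt_le_trans _ _ (lam (box 0 (const_mx m.+1%:R^-1)))); last first.
  apply: le_lebesgue_outer => x xb; rewrite /eball/=.
  rewrite -(@divff _ m.+1%:R) ?pnatr_eq0//; apply: enorm_le_sup => i.
  have := xb i; rewrite !mxE => /andP[x0 x1]; rewrite ger0_norm//.
apply: lt_le_trans (lebesgue_outer_ge_box _); last by move=> i; rewrite !mxE ltW.
by rewrite lte_fin; apply: prodr_gt0 => i _; rewrite !mxE subr0.
Qed.

Lemma eball_volume r : 0 <= r -> lam (eball r) = (omega * r ^+ m.+1)%:E.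
Proof.
rewrite le_eqVlt => /predU1P[<-|r0].
  rewrite expr0n mulr0; apply/eqP; rewrite eq_le lebesgue_outer_ge0 andbT.
  apply: le_trans (lebesgue_outer_le_box (a := 0) (b := 0) _ _) _.
  - by move=> i.
  - move=> x /= x0 i; have := le_trans (le_coord_enorm x i) x0.
    by rewrite normr_le0 => /eqP ->; rewrite mxE lexx.
  - by rewrite big_ord_recl subrr mul0r.
rewrite mulrC EFinM -eball1_volume -lebesgue_outer_scale//; congr lebesgue_outer.
apply/seteqP; split => [x xr|_ [x /= x1 <-]]; last first.
  by rewrite /eball/= enormZ gtr0_norm// -[leRHS]mulr1 ler_pM2l.
exists (r^-1 *: x); last by rewrite scalerA divff ?gt_eqF// scale1r.
by rewrite /eball/= enormZ gtr0_norm ?invr_gt0// ler_pdivrMl// mulr1.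
Qed.

(* The volume of the ball bounded by the sphere through [x], used as a radial
   coordinate. *)
Definition radvol (x : V) : R := omega * enorm x ^+ m.+1.

Lemma radvol_ge0 x : 0 <= radvol x.
Proof. by rewrite mulr_ge0 ?exprn_ge0 ?enorm_ge0// ltW// omega_gt0. Qed.

Lemma exists_radius v : 0 <= v -> exists2 r, 0 <= r & v = omega * r ^+ m.+1.
Proof.
move=> v0; have o0 := omega_gt0; have vo : 0 <= v / omega by rewrite divr_ge0// ltW.
exists ((v / omega) `^ (m.+1%:R^-1)); first exact: powR_ge0.
rewrite -powR_mulrn ?powR_ge0// -powRrM mulVf ?pnatr_eq0// powRr1//.
by rewrite mulrC divfK// gt_eqF.
Qed.

Lemma le_radvol (r s : R) : 0 <= r -> 0 <= s ->
  (omega * r ^+ m.+1 <= omega * s ^+ m.+1) = (r <= s).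
Proof. by move=> r0 s0; rewrite ler_pM2l ?omega_gt0// ler_pXn2r. Qed.

Lemma lt_radvol (r s : R) : 0 <= r -> 0 <= s ->
  (omega * r ^+ m.+1 < omega * s ^+ m.+1) = (r < s).
Proof. by move=> r0 s0; rewrite ltr_pM2l ?omega_gt0// ltr_pXn2r. Qed.

Definition vball (v : R) : set V := [set x | radvol x <= v].

Definition vsphere (v : R) : set V := [set x | radvol x = v].

Lemma vballE r : 0 <= r -> vball (omega * r ^+ m.+1) = eball r.
Proof.
by move=> r0; apply/seteqP; split => x; rewrite /vball/= /eball/= le_radvol ?enorm_ge0.
Qed.

Lemma vsphereE r : 0 <= r -> vsphere (omega * r ^+ m.+1) = [set x | enorm x = r].
Proof.
move=> r0; apply/seteqP; split => x /=; last by move=> <-.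
by move=> /eqP; rewrite eq_le !le_radvol ?enorm_ge0// -eq_le => /eqP.
Qed.

Lemma vball_neg v : v < 0 -> vball v = set0.
Proof.
move=> v0; apply/seteqP; split => // x /= xv.
by have := le_lt_trans (le_trans (radvol_ge0 x) xv) v0; rewrite ltxx.
Qed.

Lemma vball_measurable v : lebesgue_measurable (vball v).
Proof.
have [/vball_neg ->|v0] := ltP v 0; first exact: caratheodory_measurable_set0.
by have [r r0 ->] := exists_radius v0; rewrite vballE//; exact: eball_caratheodory.
Qed.

Lemma vball_volume v : lam (vball v) = (Num.max v 0)%:E.
Proof.
have [v0|v0] := ltP v 0; first by rewrite vball_neg// lebesgue_outer0.
by have [r r0 ->] := exists_radius v0; rewrite vballE// eball_volume.
Qed.

(** Half-open, so that consecutive shells tile; bounded by volumes, so that its own volume is a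
    difference of parameters. *)
Definition shell (u v : R) : set V := [set x | u < radvol x <= v].

Lemma shellE u v : shell u v = vball v `&` ~` vball u.
Proof.
apply/seteqP; split => x; rewrite /shell/vball/=.
  by move=> /andP[h ->]; split => //; apply/negP; rewrite -ltNge.
by move=> [-> /negP]; rewrite -ltNge => ->.
Qed.

Lemma shell_measurable u v : lebesgue_measurable (shell u v).
Proof.
rewrite shellE; apply: caratheodory_measurable_setI; first exact: vball_measurable.
by apply: caratheodory_measurable_setC; exact: vball_measurable.
Qed.

(** Balls of negative parameter are empty, hence the truncation at 0. A shell with negative inner
    parameter contains the origin. *)
Lemma shell_volume u v : u <= v -> lam (shell u v) = (Num.max v 0 - Num.max u 0)%:E.
Proof.
move=> uv; have := vball_measurable u (vball v).
have -> : vball v `&` vball u = vball u.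
  by apply/setIidr => x /= /le_trans; apply.
rewrite -shellE !vball_volume => h.
have fin : lam (shell u v) \is a fin_num.
  rewrite ge0_fin_numE ?lebesgue_outer_ge0//.
  apply: le_lt_trans (_ : (_ <= (Num.max v 0)%:E)%E) (ltry _).
  by rewrite h leeDr// lee_fin le_max lexx orbT.
by rewrite EFinB h [X in (X - _)%E]addeC addeK.
Qed.

(** Supplies the positive distance that [hausdorff_metric_additive] asks for. *)
Lemma vball_vsep u w : u < w -> exists2 g : R, 0 < g &
  forall x y, vball u x -> w < radvol y -> g <= enorm (x - y).
Proof.
move=> uw; have [u0|u0] := ltP u 0.
  by exists 1 => // x y; rewrite vball_neg.
have w0 : 0 <= w by exact: le_trans (ltW uw).
have [r r0 ur] := exists_radius u0; have [s s0 ws] := exists_radius w0.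
exists (s - r); first by rewrite subr_gt0 -lt_radvol// -ur -ws.
move=> x y; rewrite ur vballE// ws lt_radvol ?enorm_ge0//= => xr ys.
have := ler_enorm_sub y x; rewrite -(opprB x) enormN.
by rewrite /eball/= in xr; lra.
Qed.

Lemma nbhs_radvol_lt x v : radvol x < v -> nbhs x [set y | radvol y < v].
Proof.
move=> xv; have v0 : 0 <= v by rewrite (le_trans (radvol_ge0 x))// ltW.
have [r r0 vr] := exists_radius v0; move: xv; rewrite vr lt_radvol ?enorm_ge0// => xr.
have e0 : 0 < r - enorm x by rewrite subr_gt0.
apply: filterS (nbhs_enorm x e0) => y /= xy; rewrite lt_radvol ?enorm_ge0//.
by have := ler_enorm_sub y x; rewrite -(opprB x) enormN; lra.
Qed.

Lemma nbhs_radvol_gt x v : v < radvol x -> nbhs x [set y | v < radvol y].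
Proof.
move=> xv; have [v0|v0] := ltP v 0.
  apply: filterS (@filterT _ (nbhs x) _) => y _.
  exact: lt_le_trans (radvol_ge0 y).
have [r r0 vr] := exists_radius v0; move: xv; rewrite vr lt_radvol ?enorm_ge0// => xr.
have e0 : 0 < enorm x - r by rewrite subr_gt0.
apply: filterS (nbhs_enorm x e0) => y /= xy; rewrite lt_radvol ?enorm_ge0//.
by have := ler_enorm_sub x y; lra.
Qed.

Lemma hausdorff_vsphere_finite v : 0 < v -> (hausdorff m (vsphere v) < +oo)%E.
Proof.
move=> v0; have [r r0 vr] := exists_radius (ltW v0).
have {}r0 : 0 < r.
  rewrite lt_neqAle r0 andbT; apply/eqP => r0'.
  by move: v0; rewrite vr -r0' expr0n mulr0 ltxx.
rewrite vr vsphereE ?ltW//; have [C _ hC] := @hausdorff_sphere_le R m.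
exact: le_lt_trans (hC r r0) (ltry _).
Qed.

(** The area is at most a multiple of r^m, whereas the volume is a multiple of r^(m+1). *)
Lemma hausdorff_vsphere_small e : 0 < e ->
  \forall v \near +oo, (hausdorff m (vsphere v) <= (e * v)%:E)%E.
Proof.
move=> e0; have [C C0 hC] := @hausdorff_sphere_le R m; have o0 := omega_gt0.
pose q := 1 + C / (omega * e).
have q0 : 0 < q by rewrite ltr_pwDl// divr_ge0// mulr_ge0// ltW.
near=> v; have v0 : 0 <= v by near: v; exact: nbhs_pinfty_ge.
have [r r0 vr] := exists_radius v0.
have qr : q <= r.
  by rewrite -le_radvol ?(ltW q0)// -vr; near: v; apply: nbhs_pinfty_ge; exact: num_real.
have {}r0 : 0 < r by exact: lt_le_trans q0 qr.
rewrite vr (vsphereE (ltW r0)); apply: le_trans (hC r r0) _.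
rewrite lee_fin exprS !mulrA ler_wpM2r ?exprn_ge0 ?(ltW r0)//.
have : C / (omega * e) <= r by apply: le_trans _ qr; rewrite /q lerDr.
by rewrite ler_pdivrMr ?mulr_gt0//; nra.
Unshelve. all: by end_near. Qed.

End ball_volume.

(** * Partitions as colourings *)

Section colouring.
Context (R : realType) (m : nat) (I : Type).
Let V := 'rV[R]_m.+1.
Implicit Types c : V -> I.

(** This is the union of the boundaries of the colour classes, in a form that visibly only shrinks
    when colours are merged. *)
Definition skel c : set V := [set x | ~ nbhs x [set y | c y = c x]].

(** Indexed by points rather than colours, so that a colour not taken contributes no empty
    region. *)
Definition fibers c : set (set V) := [set [set y | c y = c x] | x in setT].

Lemma skel_sub_boundary c r :
  skel c `&` eball r `<=` \bigcup_(A in [set A `&` eball r | A in fibers c]) boundary A.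
Proof.
move=> x [xc xr]; exists ([set y | c y = c x] `&` eball r).
  by exists [set y | c y = c x] => //; exists x.
split; first exact: subset_closure.
by move=> /= xi; apply: xc; apply: filterS xi => y [].
Qed.

(** Restricting to the ball creates new boundary only on the sphere: the exterior is open and misses
    every region, and near an interior point the restriction changes nothing. *)
Lemma boundary_sub_skel c r :
  \bigcup_(A in [set A `&` eball r | A in fibers c]) boundary A `<=`
  [set x | enorm x = r] `|` (skel c `&` eball r).
Proof.
move=> x [_ [_ [z _ <-] <-] [clx nix]].
have xr : enorm x <= r.
  rewrite leNgt; apply/negP => rx.
  have e0 : 0 < enorm x - r by rewrite subr_gt0.
  have [y [[_ yr] xy]] := clx _ (nbhs_enorm x e0).
  have := ler_enorm_sub x y; rewrite /eball/= in yr; rewrite /= in xy; lra.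
have [xr'|xr'] := eqVneq (enorm x) r; first by left.
right; split => // xc; apply: nix.
have e0 : 0 < r - enorm x by rewrite subr_gt0 lt_neqAle xr' xr.
have [y [[yz _] yx]] := clx _ xc.
have xz : c x = c z by rewrite -yx -yz.
apply: filterS (filterI xc (nbhs_enorm x e0)) => t [/= tx xt]; split => /=.
  by rewrite tx.
have := ler_enorm_sub t x; rewrite /eball/= -(opprB x) enormN; lra.
Qed.

(** The argument is the volume of the ball, so that bounds on the ratio become linear bounds
    [L * v]. *)
Definition skel_area c (v : R) : \bar R := hausdorff m (skel c `&` @vball R m v).

Lemma le_skel_area_perimeter c r : 0 <= r ->
  (skel_area c (omega R m * r ^+ m.+1) <= perimeter [set A `&` eball r | A in fibers c])%E.
Proof.
by move=> r0; apply: le_hausdorff; rewrite vballE//; exact: skel_sub_boundary.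
Qed.

Lemma perimeter_le_skel_area c r : 0 <= r ->
  (perimeter [set A `&` eball r | A in fibers c] <=
   hausdorff m (@vsphere R m (omega R m * r ^+ m.+1)) + skel_area c (omega R m * r ^+ m.+1))%E.
Proof.
move=> r0; rewrite vsphereE// /skel_area vballE//.
apply: le_trans (hausdorffU _ _ _); apply: le_hausdorff.
exact: boundary_sub_skel.
Qed.

Lemma skel_area_le_of_limf_esup_lt c (L : R) :
  (limf_esup (perimeter_ratio (fibers c)) (pinfty_nbhs R) < L%:E)%E ->
  \forall v \near +oo, (skel_area c v <= (L * v)%:E)%E.
Proof.
move=> /ereal_inf_lt[_ [A [M [_ MA]] <-] AL].
near=> v; have v0 : 0 < v by near: v; exact: nbhs_pinfty_gt.
have [r r0 vr] := exists_radius m (ltW v0).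
have Mr : M < r.
  have M0 : 0 <= Num.max M 0 by rewrite le_max lexx orbT.
  apply: le_lt_trans (_ : _ <= Num.max M 0) _; first by rewrite le_max lexx.
  rewrite -(@lt_radvol _ m)// -vr; near: v; apply: nbhs_pinfty_gt; exact: num_real.
have fL : (perimeter_ratio (fibers c) r < L%:E)%E.
  by apply: le_lt_trans AL; apply: ereal_sup_ubound; exists r => //; exact: MA.
have := ltW fL; rewrite /perimeter_ratio eball_volume// -vr inver gt_eqF// lee_pdivrMr//.
rewrite EFinM; apply: le_trans; rewrite vr; exact: le_skel_area_perimeter.
Unshelve. all: by end_near. Qed.

Lemma limf_esup_le_of_skel_area_le c (L : R) :
  (\forall v \near +oo, (skel_area c v <= (L * v)%:E)%E) ->
  (limf_esup (perimeter_ratio (fibers c)) (pinfty_nbhs R) <= L%:E)%E.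
Proof.
move=> cL; apply/lee_addgt0Pr => e e0.
have : \forall v \near +oo, [/\ 0 < v, (skel_area c v <= (L * v)%:E)%E &
    (hausdorff m (@vsphere R m v) <= (e * v)%:E)%E].
  near=> v; split; near: v => //; first exact: nbhs_pinfty_gt.
  exact: hausdorff_vsphere_small.
move=> [M [_ MP]].
(* For [r > q] one has [r >= 1], so omega r^(m+1) >= omega r > |M|. *)
pose q := 1 + `|M| / omega R m.
have o0 := omega_gt0 R m.
have q1 : 1 <= q by rewrite lerDl divr_ge0// ltW.
apply: ge_ereal_inf.
exists (ereal_sup (perimeter_ratio (fibers c) @` [set r | q < r])).
  by exists [set r | q < r] => //; exists q; split => //; exact: num_real.
apply: ge_ereal_sup => _ [r /= qr <-].
have r1 : 1 <= r by rewrite (le_trans q1)// ltW.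
have r0 : 0 <= r by rewrite (le_trans _ r1).
have Mr : M < omega R m * r ^+ m.+1.
  apply: le_lt_trans (ler_norm M) _; rewrite mulrC -ltr_pdivrMr//.
  apply: (@lt_le_trans _ _ r); last by rewrite -[leLHS]expr1 ler_weXn2l.
  by apply: le_lt_trans qr; rewrite /q lerDr.
have [v0 h1 h2] := MP _ Mr.
rewrite /perimeter_ratio eball_volume// inver gt_eqF// lee_pdivrMr//.
apply: le_trans (perimeter_le_skel_area c r0) _.
apply: le_trans (leeD h2 h1) _.
by rewrite -EFinD -EFinM lee_fin -mulrDl addrC.
Unshelve. all: by end_near. Qed.

(** Otherwise [skel_area] would eventually lie below [(a - e) * v], and the limit superior would be
    at most [a - e]. The predicate [P] lets such a [v] meet all other demands of the
    construction. *)
Lemma skel_area_frequently_ge c (a e : R) : 0 < e ->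
  (a%:E <= limf_esup (perimeter_ratio (fibers c)) (pinfty_nbhs R))%E ->
  forall P : R -> Prop, (\forall v \near +oo, P v) ->
  exists2 v, P v & (((a - e) * v)%:E <= skel_area c v)%E.
Proof.
move=> e0 ac P nP; apply: contrapT => nex.
have : (limf_esup (perimeter_ratio (fibers c)) (pinfty_nbhs R) <= (a - e)%:E)%E.
  apply: limf_esup_le_of_skel_area_le; apply: filterS nP => v Pv.
  by rewrite leNgt; apply/negP => /ltW h; apply: nex; exists v.
move=> /(le_trans ac); rewrite lee_fin; lra.
Qed.

End colouring.

Section partition.
Context (R : realType) (m : nat).
Let V := 'rV[R]_m.+1.

Lemma fibers_unit_partition (I : countType) (c : V -> I) :
  (forall x, lebesgue_measurable [set y | c y = c x] /\
             lebesgue_outer [set y | c y = c x] = 1%E) ->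
  unit_partition (fibers c).
Proof.
move=> cP; split.
- have -> : fibers c = [set [set y | c y = i] | i in range c].
    by rewrite image_comp.
  exact: sub_countable (card_image_le _ _) (countableP _).
- move=> A B [x _ <-] [y _ <-] /= [z [/= zx zy]].
  by rewrite -zx -zy.
- by apply/seteqP; split => // x _; exists [set y | c y = c x] => //; exists x.
- by move=> _ [x _ <-]; exact: cP.
Qed.

(** Countability numbers the regions, and each point gets the number of its region. A number not
    taken has an empty class, hence a bound by 1 instead of an equality. *)
Lemma unit_partition_fibers (P : set (set V)) : unit_partition P ->
  exists c : V -> nat, [/\ P = fibers c,
    forall i, lebesgue_measurable (c @^-1` [set i]) &
    forall i, (lebesgue_outer (c @^-1` [set i]) <= 1)%E].
Proof.
move=> [/pcard_leTP/injPex[/= f finj] tP cP vP].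
have [A AP] : {A : V -> set V & forall x, P (A x) /\ A x x}.
  apply: (@choice V (set V) (fun x B => P B /\ B x)) => x; have : setT x by [].
  by rewrite -cP => -[A PA Ax]; exists A.
pose c x := f (A x).
have AE B x : P B -> B x -> A x = B.
  move=> PB Bx; have [PA Ax] := AP x; apply: tP => //; by exists x.
have fib B x : P B -> B x -> c @^-1` [set c x] = B.
  move=> PB Bx; have [PA Ax] := AP x; apply/seteqP; split => y /=.
    have [PAy Ay] := AP y => /finj; rewrite !inE => /(_ PAy PA).
    by rewrite (AE _ _ PB Bx) => <-.
  by move=> By; rewrite /c (AE _ _ PB Bx) (AE _ _ PB By).
have or0 i : P (c @^-1` [set i]) \/ c @^-1` [set i] = set0.
  have [[x xi]|ni] := pselect (exists x, c x = i); last first.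
    by right; apply/seteqP; split => // x xi; apply: ni; exists x.
  by left; have [PA Ax] := AP x; rewrite -xi (fib (A x)).
exists c; split.
- apply/seteqP; split => [B PB|_ [x _ <-]].
    have [x Bx] : B !=set0.
      apply/set0P/eqP => B0; have [_] := vP B PB.
      by rewrite B0 lebesgue_outer0 => /eqP; rewrite eq_sym onee_eq0.
    by exists x => //; exact: fib.
  by have [PA Ax] := AP x; rewrite (_ : [set _ | _] = A x)//; exact: fib.
- move=> i; have [/vP[]//|->] := or0 i; exact: caratheodory_measurable_set0.
- move=> i; have [/vP[_ ->]//|->] := or0 i; by rewrite lebesgue_outer0.
Qed.

End partition.

(** * Gluing a sequence of partitions *)

Lemma outer_disjointU (R : realType) (m : nat) (A B : set 'rV[R]_m.+1) :
  lebesgue_measurable A -> A `&` B = set0 ->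
  lebesgue_outer (A `|` B) = (lebesgue_outer A + lebesgue_outer B)%E.
Proof.
move=> mA AB; rewrite (mA (A `|` B)) setUK; congr (_ + lebesgue_outer _)%E.
by rewrite setIUl setICr set0U; apply/setIidl => x Bx Ax; suff : (A `&` B) x by rewrite AB.
Qed.

Lemma step_uniq (R : realType) (f : nat -> R) (t : R) i j :
  (forall k, f k <= f k.+1) -> f i < t <= f i.+1 -> f j < t <= f j.+1 -> i = j.
Proof.
move=> fS; have fm : {homo f : p q / (p <= q)%N >-> p <= q}.
  by apply: homo_leq => //; exact: le_trans.
have main p q : f p < t <= f p.+1 -> f q < t <= f q.+1 -> (p < q)%N -> False.
  move=> /andP[_ tp] /andP[qt _] /fm pq.
  by have := lt_le_trans qt (le_trans tp pq); rewrite ltxx.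
by move=> ti tj; have [/(main _ _ ti tj)|/(main _ _ tj ti)|] := ltngtP i j.
Qed.

Lemma step_exists (R : realType) (f : nat -> R) (t : R) n :
  f 0%N < t <= f n -> exists2 j, (j < n)%N & f j < t <= f j.+1.
Proof.
elim: n => [/andP[h1 h2]|n IH /andP[f0 fn]]; first by have := lt_le_trans h1 h2; rewrite ltxx.
have [tn|tn] := leP t (f n); last by exists n => //; rewrite tn.
by have [|j jn jt] := IH; [rewrite f0|exists j => //; exact: ltnW].
Qed.

Section gluing.
Context (R : realType) (m : nat).
Let V := 'rV[R]_m.+1.
Context (c : nat -> V -> nat) (u : nat -> R) (N : nat -> nat) (d : nat -> nat -> R)
  (J : nat -> nat).

(** The [d k j] are volumes, like the radial coordinate: where the cuts are nonnegative, the [j]-th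
    shell has volume [d k j]. *)
Definition cutpt k j : R := u k + \sum_(0 <= i < j) d k i.

(* The shells between the cuts of index [k] complete the pieces of annulus
   [k - 2].  Those of index 0 and 1 have nothing to complete and are regions by
   themselves; the cuts start at [u 0 = -1] so that the origin is covered. *)
Definition main_piece k j : set V :=
  if k is i.+2 then shell (cutpt i (N i)) (u i.+1) `&` [set x | minn (c i x) (J i) = j]
  else set0.

Definition region (p : nat * nat) : set V :=
  [set x | (p.2 < N p.1)%N /\
     (shell (cutpt p.1 p.2) (cutpt p.1 p.2.+1) `|` main_piece p.1 p.2) x].

Hypothesis d0 : forall k j, 0 <= d k j.
Hypothesis u0 : u 0%N = -1.
Hypothesis uS : forall k, u k + 1 <= u k.+1.
Hypothesis cut_gt : forall k, u k < cutpt k (N k).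
Hypothesis cut_lt : forall k, cutpt k (N k) < u k.+1.
(** The merged colours 0 to [J k] of annulus [k] receive one shell each; the shell of index
    [(J k).+1] is a region by itself. *)
Hypothesis NJ : forall k, N k.+2 = (J k).+2.
Hypothesis cm : forall k i, lebesgue_measurable (c k @^-1` [set i]).
Hypothesis region_volume : forall k j, (j < N k)%N ->
  (lebesgue_outer (shell (cutpt k j) (cutpt k j.+1) : set V) +
   lebesgue_outer (main_piece k j) = 1)%E.

Let cut0 k : cutpt k 0 = u k.
Proof. by rewrite /cutpt big_geq// addr0. Qed.

Let cutS k j : cutpt k j <= cutpt k j.+1.
Proof. by rewrite /cutpt big_nat_recr//= addrA lerDl. Qed.

Let cut_homo k : {homo cutpt k : p q / (p <= q)%N >-> p <= q}.
Proof. by apply: homo_leq => //; exact: le_trans. Qed.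

Let u_le k : u k <= u k.+1.
Proof. by apply: le_trans (uS k); rewrite lerDl. Qed.

Let u_ge k : k%:R - 1 <= u k.
Proof.
elim: k => [|k IH]; first by rewrite u0 sub0r.
by apply: le_trans (uS k); rewrite -natr1; lra.
Qed.

Let cut_zone k j (t : R) : (j < N k)%N -> cutpt k j < t <= cutpt k j.+1 -> u k < t <= u k.+1.
Proof.
move=> jN /andP[t1 t2]; rewrite -cut0 (le_lt_trans (@cut_homo k _ _ (leq0n j)) t1)//=.
by apply: le_trans t2 (le_trans (@cut_homo k _ _ jN) (ltW (cut_lt k))).
Qed.

(** The radial coordinate determines the zone and whether the point lies in a shell, and which one,
    or in the annulus beyond the last cut; there the merged colour decides. *)
Lemma region_uniq (x : V) p q : region p x -> region q x -> p = q.
Proof.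
move: p q => [k j] [k' j'] [/= jN xp] [/= j'N xq].
have pay_main l i h h' : (h < N l)%N -> shell (cutpt l h) (cutpt l h.+1) x ->
    main_piece i h' x -> False.
  case: i => [|[|i]]//= hN lx [/andP[x1 x2] _].
  have zi : u i < radvol x <= u i.+1.
    by rewrite x2 andbT (lt_trans (cut_gt i)).
  have il := step_uniq u_le (cut_zone hN lx) zi; subst l.
  have /andP[_ x3] := lx.
  by have := lt_le_trans x1 (le_trans x3 (@cut_homo _ _ _ hN)); rewrite ltxx.
case: xp xq => [xp|xp] [xq|xq].
- have kk' := step_uniq u_le (cut_zone jN xp) (cut_zone j'N xq); subst k'.
  by rewrite (step_uniq (cutS k) xp xq).
- by have := pay_main _ _ _ _ jN xp xq.
- by have := pay_main _ _ _ _ j'N xq xp.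
- case: k k' jN j'N xp xq => [|[|k]]//= [|[|k']]//= jN j'N.
  move=> [/andP[x1 x2] <-] [/andP[x3 x4] <-].
  have z1 : u k < radvol x <= u k.+1 by rewrite x2 andbT (lt_trans (cut_gt k)).
  have z2 : u k' < radvol x <= u k'.+1 by rewrite x4 andbT (lt_trans (cut_gt k')).
  by have -> := step_uniq u_le z1 z2.
Qed.

Lemma zone_exists (x : V) : exists k, u k < radvol x <= u k.+1.
Proof.
have [] := @step_exists R u (radvol x) (Num.truncn (radvol x)).+2 _; last by move=> k; exists k.
rewrite u0 (lt_le_trans _ (radvol_ge0 x)) ?ltrN10//=.
apply: le_trans (u_ge _); rewrite -natr1 addrK.
exact/ltW/truncnS_gt.
Qed.

Lemma region_exists (x : V) : exists p, region p x.
Proof.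
have [k /andP[x1 x2]] := zone_exists x.
have [xw|xw] := leP (radvol x) (cutpt k (N k)); last first.
  exists (k.+2, minn (c k x) (J k)); split => /=.
    by rewrite NJ ltnS (leq_trans (geq_minr _ _)).
  by right; split => //; rewrite /shell/= xw.
have [|j jN xj] := @step_exists R (cutpt k) (radvol x) (N k); first by rewrite cut0 x1.
by exists (k, j); split => //; left.
Qed.

Definition glued (x : V) : nat * nat := projT1 (cid (region_exists x)).

Let gluedP x : region (glued x) x.
Proof. by rewrite /glued; case: cid. Qed.

Let glued_eq x p : region p x -> glued x = p.
Proof. exact/region_uniq/gluedP. Qed.

Let minn_measurable k j :
  lebesgue_measurable [set x : V | minn (c k x) (J k) = j].
Proof.
pose T := caratheodory_type (@lebesgue_outer R m.+1).
have -> : [set x : V | minn (c k x) (J k) = j] =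
    \bigcup_(i in [set i | minn i (J k) = j]) (c k @^-1` [set i]).
  by apply/seteqP; split => [x /= xj|x [i /= ij ->]//]; exists (c k x).
apply: (@bigcup_measurable _ T) => i _; exact: cm.
Qed.

Let main_piece_measurable k j : lebesgue_measurable (main_piece k j).
Proof.
case: k => [|[|k]]; try exact: caratheodory_measurable_set0.
exact: caratheodory_measurable_setI (shell_measurable _ _) (minn_measurable k j).
Qed.

Lemma glued_unit_partition : unit_partition (fibers glued).
Proof.
apply: fibers_unit_partition => x.
have -> : [set y | glued y = glued x] = region (glued x).
  by apply/seteqP; split => y /= => [<-|/glued_eq].
have xr := gluedP x; move: (glued x) xr => [k j] [/= jN _].
have -> : region (k, j) = shell (cutpt k j) (cutpt k j.+1) `|` main_piece k j.
  by apply/seteqP; split => y /= => [[]|].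
split.
  by apply: caratheodory_measurable_setU; [exact: shell_measurable|exact: main_piece_measurable].
rewrite outer_disjointU ?region_volume//; first exact: shell_measurable.
apply/seteqP; split => // y [yp].
(* The shell lies in zone [k.+2] and the main piece in zone [k], so they are disjoint. *)
case: k jN yp => [|[|k]]//= jN yp [/andP[y1 y2] _].
have zk : u k < radvol y <= u k.+1 by rewrite y2 andbT (lt_trans (cut_gt k)).
by have /eqP := step_uniq u_le (cut_zone jN yp) zk; rewrite -[X in _ == X]addn0 -addn2 eqn_add2l.
Qed.

(** Within a zone the glued colouring is constant on each open shell, and in the open annulus it is
    locally constant wherever [c k] is. The inner sphere [u k] belongs to the preceding zone. *)
Lemma glued_skel k (x : V) : u k < radvol x <= u k.+1 -> skel glued x ->
  [\/ exists2 j, (j < N k)%N & radvol x = cutpt k j.+1, radvol x = u k.+1 |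
      cutpt k (N k) < radvol x /\ skel (c k) x].
Proof.
move=> /andP[x1 x2] sx.
have [xw|xw] := leP (radvol x) (cutpt k (N k)).
  have [|j jN /andP[xj xj1]] := @step_exists R (cutpt k) (radvol x) (N k).
    by rewrite cut0 x1.
  have [e|ne] := eqVneq (radvol x) (cutpt k j.+1); first by apply: Or31; exists j.
  exfalso; apply: sx.
  have lt : radvol x < cutpt k j.+1 by rewrite lt_neqAle ne xj1.
  have -> : glued x = (k, j) by apply: glued_eq; split => //; left; rewrite /shell/= xj xj1.
  apply: filterS (filterI (nbhs_radvol_gt xj) (nbhs_radvol_lt lt)) => y /= [y1 y2].
  by apply: glued_eq; split => //; left; rewrite /shell/= y1 ltW.
have [e|ne] := eqVneq (radvol x) (u k.+1); first exact: Or32.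
apply: Or33; split => // cx; apply: sx.
have lt : radvol x < u k.+1 by rewrite lt_neqAle ne x2.
have key y : cutpt k (N k) < radvol y -> radvol y < u k.+1 -> c k y = c k x ->
    glued y = (k.+2, minn (c k x) (J k)).
  move=> y1 y2 yx; apply: glued_eq; split => /=.
    by rewrite NJ ltnS (leq_trans (geq_minr _ _)).
  by right; split; rewrite /shell/= ?y1 ?ltW//= yx.
rewrite (key x)//.
apply: filterS (filterI cx (filterI (nbhs_radvol_gt xw) (nbhs_radvol_lt lt))) => y /= [yx [y1 y2]].
exact: key.
Qed.

Let sg v := hausdorff m (@vsphere R m v).

Let outer_part k v : set V := skel (c k) `&` [set x | cutpt k (N k) < radvol x] `&` vball v.

Lemma glued_skel_area k v : u k <= v -> v <= u k.+1 ->
  (skel_area glued v <= skel_area glued (u k) + \sum_(0 <= j < N k) sg (cutpt k j.+1)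
     + sg v + hausdorff m (outer_part k v))%E.
Proof.
move=> uv vu.
apply: (@le_trans _ _ (hausdorff m ((((skel glued `&` vball (u k)) `|`
    \big[setU/set0]_(0 <= j < N k) vsphere (cutpt k j.+1)) `|` vsphere v) `|` outer_part k v))).
  apply: le_hausdorff => x [sx xv].
  have [xk|xk] := leP (radvol x) (u k); first by do 3 left; split.
  have xk1 : radvol x <= u k.+1 by exact: le_trans vu.
  have [||[j jN xj]|xe|[xw cx]] := @glued_skel k x; rewrite ?xk//.
  - left; left; right; rewrite -bigcup_seq; exists j => //=.
    by rewrite mem_index_iota.
  (* A point on the outer sphere of the zone lies in the ball only if [v = u k.+1], so [sg v]
     accounts for it. *)
  - left; right; apply/eqP; rewrite eq_le; apply/andP; split => //.
    by rewrite xe.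
  - by right; split.
do 3 (apply: le_trans (hausdorffU _ _ _) _; apply: leeD => //).
exact: hausdorff_bigsetU.
Qed.

Let outer_part_le k v : (hausdorff m (outer_part k v) <= skel_area (c k) v)%E.
Proof. by apply: le_hausdorff => x [[]]. Qed.

(** The shells after [u k] separate the two sets, so additivity bounds the area beyond the last cut
    by a difference of two areas of [c k]. *)
Let outer_part_additive k v : u k <= v ->
  (hausdorff m (outer_part k v) + skel_area (c k) (u k) <= skel_area (c k) v)%E.
Proof.
move=> uv; have [g g0 sep] := @vball_vsep R m _ _ (cut_gt k).
rewrite addeC; apply: le_trans (hausdorff_metric_additive _ g0 _) _.
  by move=> x y [_ xu] [[_ /= wy] _]; exact: sep.
apply: le_hausdorff => x [[sx xu]|[[sx _] xv]]; split => //.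
exact: le_trans uv.
Qed.

(** * Asymptotic area of the glued partition *)

Context (a : R) (e : nat -> R).
Hypothesis a0 : 0 <= a.
Hypothesis e0 : forall k, 0 < e k <= 1.
Hypothesis eS : forall k, e k.+1 <= e k.
Hypothesis end_le : forall k, (skel_area (c k) (u k.+1) <= ((a + e k) * u k.+1)%:E)%E.
Hypothesis all_le : forall k v, u k.+1 <= v ->
  (skel_area (c k.+1) v <= ((a + e k.+1) * v)%:E)%E.
Hypothesis start_ge : forall k,
  (((a - e k.+1) * u k.+1)%:E <= skel_area (c k.+1) (u k.+1))%E.
Hypothesis sg_le : forall k v, u k.+1 <= v -> (sg v <= (e k.+1 * v)%:E)%E.
Hypothesis cuts_le : forall k,
  (\sum_(0 <= j < N k.+1) sg (cutpt k.+1 j.+1) <= (e k.+1 * u k.+1)%:E)%E.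
Hypothesis past_le : forall k,
  (((a + 3) * `|u k|)%:E + \sum_(0 <= j < N k) sg (cutpt k j.+1) <= (e k * u k.+1)%:E)%E.

Let u_pos k : 0 <= u k.+1.
Proof. by apply: le_trans (u_ge _); rewrite -natr1 addrK. Qed.

(** One [e k] each comes from the past together with the cuts, from the end sphere, and from [c k]
    in the annulus. *)
Let end_bound k : (skel_area glued (u k) <= ((a + 3) * `|u k|)%:E)%E ->
  (skel_area glued (u k.+1) <= ((a + 3 * e k) * u k.+1)%:E)%E.
Proof.
move=> past; apply: le_trans (glued_skel_area (u_le k) (lexx _)) _.
apply: (@le_trans _ _ ((e k * u k.+1)%:E + (e k * u k.+1)%:E + ((a + e k) * u k.+1)%:E)%E).
  apply: leeD; last exact: le_trans (outer_part_le _ _) (end_le k).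
  apply: leeD; first by apply: le_trans (past_le k); rewrite leeD2r.
  apply: le_trans (sg_le (lexx _)) _; rewrite lee_fin ler_wpM2r//.
by rewrite -!EFinD lee_fin le_eqVlt; apply/orP; left; apply/eqP; ring.
Qed.

(** A crude bound, closed under induction by [e k <= 1]; [past_le] makes it negligible at the end of
    the next zone. It starts with the empty ball at [u 0 = -1], whence the absolute value. *)
Let past_bound k : (skel_area glued (u k) <= ((a + 3) * `|u k|)%:E)%E.
Proof.
elim: k => [|k IH].
  rewrite /skel_area u0 vball_neg ?ltrN10// setI0 hausdorff0 lee_fin.
  by rewrite mulr_ge0// addr_ge0.
apply: le_trans (end_bound IH) _; rewrite (ger0_norm (u_pos k)) lee_fin ler_wpM2r//.
by have := e0 k; lra.
Qed.

Let zone_bound k v : u k.+1 <= v -> v <= u k.+2 ->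
  (skel_area glued v <= ((a + 7 * e k) * v)%:E)%E.
Proof.
move=> uv vu; apply: le_trans (glued_skel_area uv vu) _.
have hY : (hausdorff m (outer_part k.+1 v) <=
    ((a + e k.+1) * v - (a - e k.+1) * u k.+1)%:E)%E.
  rewrite EFinB leeBrDr//.
  apply: le_trans (le_trans (outer_part_additive uv) (all_le uv)).
  by rewrite leeD2l.
apply: le_trans (leeD (leeD (leeD (end_bound (past_bound k)) (cuts_le k)) (sg_le uv)) hY) _.
rewrite -!EFinD lee_fin.
(* The terms [a * u k.+1] cancel. The errors are 3 from [end_bound], 1 from the cuts, 1 from the
   sphere and 2 from the annulus, in all 7. *)
have := e0 k; have := eS k; have := e0 k.+1; have := u_pos k; nra.
Qed.

Lemma glued_skel_area_le k v : u k.+1 <= v -> (skel_area glued v <= ((a + 7 * e k) * v)%:E)%E.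
Proof.
move=> uv.
have em : {homo e : p q / (p <= q)%N >-> q <= p}.
  move=> p q /subnK <-; elim: (q - p)%N => [//|i IH].
  by rewrite addSn; exact: le_trans (eS _) IH.
(* The half-open intervals of [step_exists] miss the left endpoint, which is treated apart. *)
have [v1|v1] := leP v (u k.+1).
  have -> : v = u k.+1 by apply/le_anti; rewrite uv v1.
  exact: zone_bound.
pose f i := u (k.+1 + i)%N.
have [i fi] : exists i, v <= f i.
  exists (Num.truncn v).+1; apply: le_trans (u_ge _).
  rewrite addSnnS addnS -natr1 addrK natrD.
  by apply: le_trans (ltW (truncnS_gt v)) _; rewrite lerDr.
have [|j _ /andP[j1 j2]] := @step_exists R f v i; first by rewrite /f addn0 v1.
apply: le_trans (@zone_bound (k + j) v _ _) _.
- by rewrite -addSn ltW.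
- by rewrite -addSn -addnS.
rewrite lee_fin ler_wpM2r//; first by rewrite (le_trans (u_pos k)).
by rewrite lerD2l ler_pM2l// em// leq_addr.
Qed.

End gluing.

(** * Choice of the radii *)

Lemma caratheodory_nonincreasing_cvg0 (R : realType) (T : pointedType)
    (mu : {outer_measure set T -> \bar R}) (F : (set T)^nat) :
  (forall n, mu.-caratheodory (F n)) -> nonincreasing_seq F ->
  \bigcap_n F n = set0 -> (mu (F 0%N) < +oo)%E -> mu (F n) @[n --> \oo] --> 0%E.
Proof.
move=> mF Fdec F0 Foo; pose U := caratheodory_type mu.
have mF0 : mu.-caratheodory (\bigcap_n F n).
  by rewrite F0; exact: caratheodory_measurable_set0.
rewrite -(outer_measure0 mu) -F0.
exact: (@nonincreasing_cvg_mu _ U R (mu : set U -> \bar R) F Foo mF mF0 Fdec).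
Qed.

Section radii.
Context (R : realType) (m : nat).
Let V := 'rV[R]_m.+1.
Local Notation lam := (@lebesgue_outer R m.+1).
Local Notation sg v := (hausdorff m (@vsphere R m v)).

Lemma shell_finite (u v : R) : (lam (shell u v) < +oo)%E.
Proof.
apply: le_lt_trans (_ : (_ <= lam (vball v))%E) _; last by rewrite vball_volume ltry.
by apply: le_lebesgue_outer => x /= /andP[].
Qed.

Lemma preimage_ge_measurable (c : V -> nat) j :
  (forall i, lebesgue_measurable (c @^-1` [set i])) ->
  lebesgue_measurable [set x | (j <= c x)%N].
Proof.
move=> cm; pose T := caratheodory_type lam.
have -> : [set x | (j <= c x)%N] = \bigcup_(i in [set i | (j <= i)%N]) (c @^-1` [set i]).
  by apply/seteqP; split => [x /= xj|x [i /= ij ->]//]; exists (c x).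
by apply: (@bigcup_measurable _ T) => i _; exact: cm.
Qed.

(** The tails decrease to the empty set inside a shell of finite volume. This yields the colour from
    which on all colours merge into one piece. *)
Lemma exists_small_tail (c : V -> nat) (u v : R) :
  (forall i, lebesgue_measurable (c @^-1` [set i])) ->
  exists J, (lam (shell u v `&` [set x | (J <= c x)%N]) <= 1)%E.
Proof.
move=> cm; pose F J : set V := shell u v `&` [set x : V | (J <= c x)%N].
have mF J : lam.-caratheodory (F J).
  apply: caratheodory_measurable_setI; first exact: shell_measurable.
  exact: preimage_ge_measurable.
have F0 : \bigcap_J F J = set0.
  by apply/seteqP; split => // x /(_ (c x).+1 I) [_ /=]; rewrite ltnn.
have Foo : (lam (F 0%N) < +oo)%E.
  apply: le_lt_trans (shell_finite u v); apply: le_lebesgue_outer; exact: subIsetl.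
have Fdec : nonincreasing_seq F.
  move=> p q pq; apply/subsetPset => x [xs /= xq]; split => //=; exact: leq_trans xq.
have /fine_cvgP[Ffin Fcvg] := caratheodory_nonincreasing_cvg0 mF Fdec F0 Foo.
near \oo => J; exists J.
have Jfin : lam (F J) \is a fin_num by near: J.
rewrite -(fineK Jfin) lee_fin; near: J; apply: cvgr_le; [exact: Fcvg|exact: ltr01].
Unshelve. all: by end_near. Qed.

(** Index [J.+1] exceeds every merged colour and has debt 1: its shell is a whole region, and it
    gives the payment zone positive thickness. *)
Definition debt (c : V -> nat) (w v : R) (J j : nat) : R :=
  if (j <= J)%N then 1 - fine (lam (shell w v `&` [set x | minn (c x) J = j])) else 1.

(** A colour below [J] keeps part of its old class, and every other merged class is contained in the
    tail. *)
Lemma merged_volume (c : V -> nat) (w v : R) (J j : nat) :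
  (forall i, (lam (c @^-1` [set i]) <= 1)%E) ->
  (lam (shell w v `&` [set x | (J <= c x)%N]) <= 1)%E ->
  exists2 t : R, lam (shell w v `&` [set x | minn (c x) J = j]) = t%:E & t <= 1.
Proof.
move=> c1 tail.
have h : (lam (shell w v `&` [set x | minn (c x) J = j]) <= 1)%E.
  have [jJ|Jj] := ltnP j J.
    apply: le_trans (c1 j); apply: le_lebesgue_outer => x [_ /=].
    by rewrite /minn; case: ltnP => // _ Jj; rewrite -Jj ltnn in jJ.
  apply: le_trans tail; apply: le_lebesgue_outer => x [xs /= xj]; split => //=.
  by apply: leq_trans Jj _; rewrite -xj geq_minl.
have fin : lam (shell w v `&` [set x | minn (c x) J = j]) \is a fin_num.
  by rewrite ge0_fin_numE ?lebesgue_outer_ge0//; exact: le_lt_trans h (ltry _).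
exists (fine (lam (shell w v `&` [set x | minn (c x) J = j]))); first by rewrite fineK.
by rewrite -lee_fin fineK.
Qed.

Lemma near_pinfty_forall_ge (P : R -> Prop) :
  (\forall v \near +oo, P v) -> \forall v \near +oo, forall w, v <= w -> P w.
Proof.
by move=> [M [Mr MP]]; exists M; split => // v Mv w vw; apply: MP; exact: lt_le_trans vw.
Qed.

(** The offsets [D j] stay fixed while [v] grows, so finitely many negligible areas are added. *)
Lemma near_spheres_small (N : nat) (D : nat -> R) (e : R) : 0 < e ->
  \forall v \near +oo, (\sum_(0 <= j < N) sg (v + D j) <= (e * v)%:E)%E.
Proof.
move=> e0; elim: N e e0 => [|N IH] e e0.
  near=> v; have v0 : 0 <= v by near: v; exact: nbhs_pinfty_ge.
  by rewrite big_geq// lee_fin mulr_ge0// ltW.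
have e2 : 0 < e / 2 by rewrite divr_gt0.
(* The last sphere has parameter [v + D N], at most [2 * v], so [e / 4] leaves [e / 2] for it. *)
have e4 : 0 < e / 4 by rewrite divr_gt0.
have [M [_ sgM]] := hausdorff_vsphere_small m e4.
near=> v; rewrite big_nat_recr//=.
have vM : M - D N < v by near: v; apply: nbhs_pinfty_gt; exact: num_real.
have vD : D N <= v by near: v; apply: nbhs_pinfty_ge; exact: num_real.
have h1 : (\sum_(0 <= j < N) sg (v + D j) <= (e / 2 * v)%:E)%E by near: v; exact: IH.
apply: le_trans (leeD h1 (sgM _ _)) _; first by lra.
by rewrite -EFinD lee_fin; nra.
Unshelve. all: by end_near. Qed.

Context (c : nat -> V -> nat) (a : R) (e : nat -> R).
Hypothesis cm : forall k i, lebesgue_measurable (c k @^-1` [set i]).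
Hypothesis c1 : forall k i, (lam (c k @^-1` [set i]) <= 1)%E.
Hypothesis e0 : forall k, 0 < e k.
Hypothesis c_le : forall k,
  \forall v \near +oo, (skel_area (c k) v <= ((a + e k) * v)%:E)%E.
Hypothesis c_ge : forall k (P : R -> Prop), (\forall v \near +oo, P v) ->
  exists2 v, P v & (((a - e k) * v)%:E <= skel_area (c k) v)%E.

(* [len0] are the debts paid in the shells that start at [pos]; [len1] those
   left for the next payment zone. *)
Record stage := Stage {
  idx : nat; pos : R; cnt0 : nat; len0 : nat -> R; cnt1 : nat; len1 : nat -> R }.

Let stage_cut s j := pos s + \sum_(0 <= i < j) len0 s i.

(** Positive totals give the gap after each [pos]; positive cuts bound spheres of finite area. *)
Definition stage_ok s := [/\ forall j, 0 <= len0 s j, forall j, 0 <= len1 s j,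
  0 < \sum_(0 <= i < cnt0 s) len0 s i, 0 < \sum_(0 <= i < cnt1 s) len1 s i &
  forall j, 0 < stage_cut s j.+1].

(** The debts of annulus [k] depend on its end [v], whereas the spheres starting at [v] must be
    small compared with [v], so their spacing has to be known beforehand. Hence those debts wait one
    more zone. *)
Definition stage_next s s' (J : nat) :=
  let k := idx s in let v := pos s' in let w := stage_cut s (cnt0 s) in
  [/\ idx s' = k.+1, cnt0 s' = cnt1 s, len0 s' = len1 s, cnt1 s' = J.+2 &
      len1 s' = debt (c k) w v J] /\
  [/\ pos s + 1 <= v, w < v, 1 <= v &
      (lam (shell w v `&` [set x | (J <= c k x)%N]) <= 1)%E] /\
  [/\ (skel_area (c k) v <= ((a + e k) * v)%:E)%E,
      forall v', v <= v' -> (skel_area (c k.+1) v' <= ((a + e k.+1) * v')%:E)%E &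
      (((a - e k.+1) * v)%:E <= skel_area (c k.+1) v)%E] /\
  [/\ forall v', v <= v' -> (sg v' <= (e k.+1 * v')%:E)%E,
      (\sum_(0 <= j < cnt0 s') sg (stage_cut s' j.+1) <= (e k.+1 * v)%:E)%E &
      (((a + 3) * `|pos s|)%:E + \sum_(0 <= j < cnt0 s) sg (stage_cut s j.+1)
         <= (e k * v)%:E)%E].

(** Order of choice: first a large [v] at which [c k.+1] has nearly the full ratio, then the tail
    index [J] of the annulus ending at [v], then its debts. *)
Lemma stage_next_exists s : stage_ok s ->
  exists s', stage_ok s' /\ exists J, stage_next s s' J.
Proof.
case: s => k p n0 l0 n1 l1 [/= l0ge l1ge l0gt l1gt cutgt].
pose w := p + \sum_(0 <= i < n0) l0 i.
(* The total to be made negligible is finite, so [v >= t / e k] suffices. *)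
have [t tE] : exists t : R,
    ((a + 3) * `|p|)%:E + \sum_(0 <= j < n0) sg (p + \sum_(0 <= i < j.+1) l0 i) = t%:E.
  exists (fine (((a + 3) * `|p|)%:E + \sum_(0 <= j < n0) sg (p + \sum_(0 <= i < j.+1) l0 i))).
  rewrite fineK// fin_numD/=; apply/sum_fin_numP => j _ _.
  by rewrite ge0_fin_numE ?hausdorff_ge0//; apply: hausdorff_vsphere_finite; exact: cutgt.
have nearP : \forall v \near +oo, [/\ p + 1 <= v, w < v & 1 <= v] /\
   [/\ (skel_area (c k) v <= ((a + e k) * v)%:E)%E,
     forall v', v <= v' -> (skel_area (c k.+1) v' <= ((a + e k.+1) * v')%:E)%E,
     forall v', v <= v' -> (sg v' <= (e k.+1 * v')%:E)%E,
     (\sum_(0 <= j < n1) sg (v + \sum_(0 <= i < j.+1) l1 i) <= (e k.+1 * v)%:E)%E &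
     t / e k <= v].
  near=> v; split; split; near: v.
  - by apply: nbhs_pinfty_ge; exact: num_real.
  - by apply: nbhs_pinfty_gt; exact: num_real.
  - by apply: nbhs_pinfty_ge; exact: num_real.
  - exact: c_le.
  - by apply: near_pinfty_forall_ge; exact: c_le.
  - by apply: near_pinfty_forall_ge; exact: hausdorff_vsphere_small.
  - exact: near_spheres_small.
  - by apply: nbhs_pinfty_ge; exact: num_real.
have [v [[v1 v2 v3] [v4 v5 v6 v7 v8]] v9] := @c_ge k.+1 _ nearP.
have [J tail] := @exists_small_tail (c k) w v (@cm k).
exists (Stage k.+1 v n1 l1 J.+2 (debt (c k) w v J)); split.
  have debt_ge0 j : 0 <= debt (c k) w v J j.
    rewrite /debt; case: ifP => // _.
    have [r -> r1] := @merged_volume (c k) w v J j (c1 k) tail.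
    by rewrite subr_ge0.
  split => //=.
    rewrite big_nat_recr//=; apply: ltr_wpDl; first exact: sumr_ge0.
    by rewrite /debt ltnn.
  by move=> j; rewrite ltr_wpDr ?sumr_ge0// (lt_le_trans ltr01).
exists J; split; [by []|split; [by []|split; [by []|split => //=]]].
by rewrite tE lee_fin mulrC -ler_pdivrMr.
Unshelve. all: by end_near. Qed.

Lemma exists_radii : exists (u : nat -> R) (N : nat -> nat) (d : nat -> nat -> R) (J : nat -> nat),
  [/\ u 0%N = -1, N 0%N = 1%N, N 1%N = 1%N, d 0%N 0%N = 2 & d 1%N 0%N = 1] /\
  [/\ forall k j, 0 <= d k j, forall k, u k < cutpt u d k (N k),
      forall k, N k.+2 = (J k).+2 &
      forall k, d k.+2 = debt (c k) (cutpt u d k (N k)) (u k.+1) (J k)] /\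
  (forall k,
    [/\ u k + 1 <= u k.+1, cutpt u d k (N k) < u k.+1, 1 <= u k.+1 &
      (lam (shell (cutpt u d k (N k)) (u k.+1) `&` [set x | (J k <= c k x)%N]) <= 1)%E] /\
    [/\ (skel_area (c k) (u k.+1) <= ((a + e k) * u k.+1)%:E)%E,
      forall v, u k.+1 <= v -> (skel_area (c k.+1) v <= ((a + e k.+1) * v)%:E)%E &
      (((a - e k.+1) * u k.+1)%:E <= skel_area (c k.+1) (u k.+1))%E] /\
    [/\ forall v, u k.+1 <= v -> (sg v <= (e k.+1 * v)%:E)%E,
      (\sum_(0 <= j < N k.+1) sg (cutpt u d k.+1 j.+1) <= (e k.+1 * u k.+1)%:E)%E &
      (((a + 3) * `|u k|)%:E + \sum_(0 <= j < N k) sg (cutpt u d k j.+1)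
         <= (e k * u k.+1)%:E)%E]).
Proof.
(* Zone 0 has one shell from -1 to 1, a ball of volume 1, and zone 1 one shell of volume 1. *)
have ok0 : stage_ok (Stage 0 (-1) 1 (fun=> 2) 1 (fun=> 1)).
  split => //=; rewrite ?big_nat1//.
  move=> j; rewrite /stage_cut/= big_nat_recl//=.
  have : 0 <= \sum_(0 <= i < j) 2 :> R by apply: sumr_ge0.
  lra.
pose X := {s | stage_ok s}.
have next (x : X) : {y : X | exists J, stage_next (sval x) (sval y) J}.
  case: x => s sok; apply: cid; have [s' [ok' sJ]] := stage_next_exists sok.
  by exists (exist _ s' ok').
have [f [f0 fS]] := dependent_choice next (exist _ _ ok0).
have [J fJ] := choice fS.
pose s k := sval (f k).
have sok k : stage_ok (s k) by exact: (svalP (f k)).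
have s0 : s 0%N = Stage 0 (-1) 1 (fun=> 2) 1 (fun=> 1) by rewrite /s f0.
have idxE k : idx (s k) = k.
  elim: k => [|k IH]; first by rewrite s0.
  by have [[-> _ _ _ _] _] := fJ k; rewrite IH.
have [[_ N1 d1 _ _] _] := fJ 0%N; rewrite -!/(s _) s0/= in N1 d1.
exists (fun k => pos (s k)), (fun k => cnt0 (s k)), (fun k => len0 (s k)), J.
split; first by rewrite s0 N1 d1.
split.
  split.
  - by move=> k; have [] := sok k.
  - by move=> k; have [_ _ h _ _] := sok k; rewrite /cutpt ltrDl.
  - move=> k; have [[_ -> _ _ _] _] := fJ k.+1.
    by have [[_ _ _ -> _] _] := fJ k.
  - move=> k; have [[_ _ -> _ _] _] := fJ k.+1.
    by have [[_ _ _ _ ->] _] := fJ k; rewrite -/(s k) idxE.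
move=> k; have [_ h] := fJ k; rewrite -!/(s _) idxE in h.
exact: h.
Qed.

End radii.

(** * Existence of a minimizer *)

Lemma unit_partition_exists (R : realType) (m : nat) :
  exists P : set (set 'rV[R]_m.+1), unit_partition P.
Proof.
(* Concentric shells of volume 1; the start at -1 puts the origin into the first one. *)
pose f k : R := if k is j.+1 then j.+1%:R else -1.
have fS k : f k <= f k.+1 by case: k => [|k]; rewrite /f ?ler_nat//; lra.
have ex (x : 'rV[R]_m.+1) : exists j, f j < radvol x <= f j.+1.
  have [] := @step_exists R f (radvol x) (Num.truncn (radvol x)).+1 _; last by move=> j; exists j.
  by rewrite (lt_le_trans _ (radvol_ge0 x)) ?ltrN10//= ltW// truncnS_gt.
have [c cP] := choice ex.
exists (fibers c); apply: fibers_unit_partition => x.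
have -> : [set y | c y = c x] = shell (f (c x)) (f (c x).+1).
  apply/seteqP; split => y /=; first by move=> <-; exact: cP.
  by move=> yx; exact: step_uniq fS (cP y) yx.
split; first exact: shell_measurable.
rewrite shell_volume//; congr EFin; case: (c x) => [|k] /=.
  rewrite (max_idPl _) ?ler0n// (max_idPr _) ?subr0//; lra.
by rewrite !(max_idPl _) ?ler0n// -(natr1 k.+1) addrAC subrr add0r.
Qed.

Lemma limf_esup_perimeter_ratio_ge0 (R : realType) (m : nat) (P : set (set 'rV[R]_m.+1)) :
  (0 <= limf_esup (perimeter_ratio P) (pinfty_nbhs R))%E.
Proof.
apply: limf_esup_ge0 => [[M [_ /(_ (M + 1))]]|r]; first by apply; rewrite ltrDl.
by rewrite mule_ge0 ?hausdorff_ge0// inve_ge0 lebesgue_outer_ge0.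
Qed.

Section minimizer.
Context (R : realType) (m : nat).
Let V := 'rV[R]_m.+1.
Local Notation limratio P := (limf_esup (perimeter_ratio P) (pinfty_nbhs R)).

Lemma glued_minimizer (c : nat -> V -> nat) (a : R) (e : nat -> R) :
  (forall k i, lebesgue_measurable (c k @^-1` [set i])) ->
  (forall k i, (lebesgue_outer (c k @^-1` [set i]) <= 1)%E) ->
  0 <= a -> (forall k, 0 < e k <= 1) -> (forall k, e k.+1 <= e k) -> e k @[k --> \oo] --> 0 ->
  (forall k, (limratio (fibers (c k)) < (a + e k)%:E)%E) ->
  (forall k, (a%:E <= limratio (fibers (c k)))%E) ->
  exists P : set (set V), unit_partition P /\ (limratio P <= a%:E)%E.
Proof.
move=> cm c1 a0 e01 eS ecvg clt cge.
have e0 k : 0 < e k by have /andP[] := e01 k.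
have [u [N [d [J [[u0 N0 N1 d00 d10] [[dge ugt NJ dJ] step]]]]]] :=
  exists_radii cm c1 e0 (fun k => skel_area_le_of_limf_esup_lt (clt k))
    (fun k => skel_area_frequently_ge (e0 k) (cge k)).
have uS k : u k + 1 <= u k.+1 by have [[]] := step k.
have ult k : cutpt u d k (N k) < u k.+1 by have [[]] := step k.
have u1 k : 1 <= u k.+1 by have [[]] := step k.
have cutp_ge k j : u k <= cutpt u d k j by rewrite lerDl sumr_ge0.
have cutpS k j : cutpt u d k j.+1 = cutpt u d k j + d k j.
  by rewrite /cutpt big_nat_recr//= addrA.
have vol k j : (j < N k)%N ->
    (lebesgue_outer (shell (cutpt u d k j) (cutpt u d k j.+1) : set V) +
     lebesgue_outer (main_piece c u N d J k j) = 1)%E.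
  move=> jN; rewrite shell_volume ?cutpS ?lerDl//.
  have pos i : 0 <= cutpt u d i.+1 j by rewrite (le_trans _ (cutp_ge _ _))// (le_trans _ (u1 i)).
  have posD i : 0 <= cutpt u d i.+1 j + d i.+1 j by rewrite addr_ge0 ?pos.
  have max0 (x : R) : 0 <= x -> Num.max x 0 = x by move=> /max_idPl.
  case: k jN => [|[|k]] jN; rewrite /main_piece.
  - move: jN; rewrite N0 ltnS leqn0 => /eqP ->.
    rewrite lebesgue_outer0 adde0 /cutpt big_geq// u0 d00 addr0; congr EFin.
    rewrite max0 ?(max_idPr _); lra.
  - rewrite lebesgue_outer0 adde0 !max0 ?posD ?pos//.
    move: jN; rewrite N1 ltnS leqn0 => /eqP ->.
    by rewrite d10 addrAC subrr add0r.
  rewrite !max0 ?posD ?pos// addrAC subrr add0r dJ /debt.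
  have [[_ _ _ tail] _] := step k.
  case: ifP => jJ.
    have [r -> _] := @merged_volume _ _ _ _ _ _ j (c1 k) tail.
    by rewrite -EFinD subrK.
  (* Here [j] exceeds every merged colour, and the shell of volume 1 is the whole region. *)
  rewrite (_ : _ `&` _ = set0) ?lebesgue_outer0 ?adde0//.
  by apply/seteqP; split => // x [_ /= xj]; move: jJ; rewrite -xj geq_minr.
exists (fibers (glued c d u0 uS NJ)); split.
  exact: glued_unit_partition.
apply/lee_addgt0Pr => r r0.
have [k ek] : exists k, 7 * e k <= r.
  have r7 : 0 < r / 7 by rewrite divr_gt0.
  near \oo => k; exists k.
  have : e k <= r / 7 by near: k; apply: cvgr_le ecvg _ r7.
  lra.
apply: (@le_trans _ _ (a + 7 * e k)%:E); last by rewrite -EFinD lee_fin lerD2l.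
apply: limf_esup_le_of_skel_area_le.
near=> v; apply: glued_skel_area_le => //.
- by move=> i; have [_ [[]]] := step i.
- by move=> i v'; have [_ [[_ + _] _]] := step i; apply.
- by move=> i; have [_ [[]]] := step i.
- by move=> i v'; have [_ [_ [+ _ _]]] := step i; apply.
- by move=> i; have [_ [_ []]] := step i.
- by move=> i; have [_ [_ []]] := step i.
Unshelve. all: by end_near. Qed.

End minimizer.

Theorem mainTheorem1 (R : realType) (n : nat) (hn : (1 <= n)%N) :
  exists Pstar : set (set 'rV[R]_n),
    unit_partition Pstar /\
    forall P : set (set 'rV[R]_n), unit_partition P ->
      (limf_esup (perimeter_ratio Pstar) (pinfty_nbhs R)
       <= limf_esup (perimeter_ratio P) (pinfty_nbhs R))%E.
Proof.
case: n hn => [//|m] _.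
pose S := [set limf_esup (perimeter_ratio P) (pinfty_nbhs R)
          | P in @unit_partition R m.+1].
have S0 : (0 <= ereal_inf S)%E.
  by apply: le_ereal_inf_tmp => _ [P _ <-]; exact: limf_esup_perimeter_ratio_ge0.
have SP (P : set (set 'rV[R]_m.+1)) : unit_partition P ->
    (ereal_inf S <= limf_esup (perimeter_ratio P) (pinfty_nbhs R))%E.
  by move=> uP; apply: ereal_inf_lbound; exists P.
(* If the infimum is infinite, every partition is a minimizer. *)
have [Soo|Soo] := eqVneq (ereal_inf S) +oo%E.
  have [P uP] := unit_partition_exists R m; exists P; split; first exact: uP.
  by move=> Q /SP; rewrite Soo leye_eq => /eqP ->; exact: leey.
have Sfin : ereal_inf S \is a fin_num by rewrite ge0_fin_numE// ltey.
pose a := fine (ereal_inf S); have aE : a%:E = ereal_inf S by rewrite fineK.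
have a0 : 0 <= a by exact: fine_ge0.
(* A minimizing sequence of partitions, with error [k.+1%:R^-1]. *)
have ex k : exists c : 'rV[R]_m.+1 -> nat, [/\
    forall i, lebesgue_measurable (c @^-1` [set i]),
    forall i, (lebesgue_outer (c @^-1` [set i]) <= 1)%E,
    (limf_esup (perimeter_ratio (fibers c)) (pinfty_nbhs R) < (a + k.+1%:R^-1)%:E)%E &
    (a%:E <= limf_esup (perimeter_ratio (fibers c)) (pinfty_nbhs R))%E].
  have : (ereal_inf S < (a + k.+1%:R^-1)%:E)%E by rewrite -aE lte_fin ltrDl invr_gt0.
  move=> /ereal_inf_lt[_ [P uP <-] Plt].
  have [c [Pc cm c1]] := unit_partition_fibers uP.
  exists c; split; [exact: cm|exact: c1|rewrite -Pc; exact: Plt|].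
  by rewrite -Pc aE; exact: SP.
have [c cP] := choice ex.
have [||||||||P [uP Pa]] := @glued_minimizer R m c a (fun k => k.+1%:R^-1).
- by move=> k; have [] := cP k.
- by move=> k; have [] := cP k.
- exact: a0.
- by move=> k; rewrite invr_gt0 ltr0n invf_le1 ?ler1n.
- by move=> k; rewrite lef_pV2 ?posrE// ler_nat.
- exact: cvg_harmonic.
- by move=> k; have [] := cP k.
- by move=> k; have [] := cP k.
exists P; split; first exact: uP.
by move=> Q /SP; rewrite -aE; exact: le_trans.
Qed.
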